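(* Let $1\le p<\infty$, $r,s\in\mathbb{N}$ with $s\le 2r$, and let $X_n=(x_{k,n})_{k=1}^n$, $n\in\mathbb{N}$, be sets of points with $0\le x_{1,n}<\dots<x_{n,n}<1$ such that, for some $\gamma\in(0,1]$, $\min_{1\le k\le n}(x_{k+1,n}-x_{k,n})\ge\gamma/n$ for all $n\in\mathbb{N}$, where $x_{n+1,n}=1+x_{1,n}$. Define, for $f\in L_p(\mathbb{T})$, $$\mathcal{K}_s(f,X_n)_p=\inf_{g\in W_p^s(\mathbb{T})}\big(\|f-g\|_{\ell_p(X_n)}+\|f-g\|_p+n^{-s}\|g^{(s)}\|_p\big).$$ Then for all $f\in L_p(\mathbb{T})$ and $n\in\mathbb{N}$ $$\mathcal{K}_s(f,X_n)_p\asymp\|f_{\gamma/n,\,r}-f\|_{\ell_p(X_n)}+\omega_s(f,1/n)_p,$$ where $\asymp$ is a two-sided inequality with positive constants independent of $f$ and $n$.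
   Context: $\mathbb{T}=[0,1)$. For $1\le p<\infty$, $L_p(\mathbb{T})$ is the space of all 1-periodic measurable functions $f$, finite at every point, with $\|f\|_p=(\int_0^1|f(x)|^p\,dx)^{1/p}<\infty$; functions coinciding almost everywhere are not identified, so $f\in L_p(\mathbb{T})$ is given by its value at each point. For $s\in\mathbb{N}$, $f\in W_p^s(\mathbb{T})$ means that $f$ is 1-periodic, $f^{(s-1)}$ is absolutely continuous and $f^{(s)}\in L_p(\mathbb{T})$. $\|f\|_{\ell_p(X_n)}=\big(\frac1n\sum_{k=1}^n|f(x_{k,n})|^p\big)^{1/p}$. Modulus of smoothness: for $s\in\mathbb{N}$, $\delta>0$, $\omega_s(f,\delta)_p=\sup_{0<h<\delta}\|\Delta_h^sf\|_p$, where $\Delta_h^sf(x)=\sum_{\nu=0}^s\binom{s}{\nu}(-1)^\nu f(x+(s-\nu)h)$. Generalized Steklov average: for $r\in\mathbb{N}$, $\delta>0$ and integrable $f$, $$f_{\delta,r}(x)=(-1)^{r+1}\binom{2r}{r}^{-1}\frac2\delta\int_{-\delta/2}^{\delta/2}\sum_{\nu=0}^{r-1}(-1)^\nu\binom{2r}{\nu}f\Big(x+\frac{r-\nu}{r}t\Big)dt .$$ *)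

(* Defs.v *)
From mathcomp Require Import all_boot all_order all_algebra.
From mathcomp Require Import all_classical all_reals all_analysis.

Set Implicit Arguments.
Unset Strict Implicit.
Unset Printing Implicit Defensive.
Import Order.TTheory GRing.Theory Num.Theory.
Import numFieldNormedType.Exports.
Local Open Scope classical_set_scope.
Local Open Scope ring_scope.

(* R with the sigma-algebra of Lebesgue (not only Borel) measurable sets. *)
Definition lebesgueR (R : realType) :=
  caratheodory_type ((@wlength R idfun)^*)%mu.

Local Notation lambda := completed_lebesgue_measure.

(* Pointwise defined functions: no identification almost everywhere. *)
Definition normLp (R : realType) (p : R) (f : R -> R) : \bar R :=
  ('N[lambda]_(p%:E)[EFin \o (f \_ `[0, 1[%classic : lebesgueR R -> R)%R])%E.

Definition Lp_torus (R : realType) (p : R) (f : R -> R) : Prop :=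
  [/\ periodic f 1,
      measurable_fun [set: lebesgueR R] (f : lebesgueR R -> R)
    & (normLp p f < +oo)%E].

Definition abs_continuous_on (R : realType) (a b : R) (f : R -> R) : Prop :=
  forall e : R, 0 < e -> exists2 d : R, 0 < d &
    forall (m : nat) (u v : 'I_m -> R),
      (forall i, [/\ a <= u i, u i <= v i & v i <= b]) ->
      trivIset [set: 'I_m] (fun i => `]u i, v i[%classic) ->
      \sum_(i < m) (v i - u i) < d ->
      \sum_(i < m) `|f (v i) - f (u i)| < e.

(* For s >= 1.  The s-th derivative exists only almost everywhere; [g^`(s)]
   takes a fixed default value where the difference quotient of [g^`(s.-1)]
   does not converge. *)
Definition Wsp (R : realType) (s : nat) (p : R) (g : R -> R) : Prop :=
  [/\ periodic g 1,
      (forall k, (k < s.-1)%N -> forall x, derivable g^`(k)%classic x 1),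
      (forall a b, abs_continuous_on a b g^`(s.-1)%classic)
    & Lp_torus p g^`(s)%classic].

(* The points of X_n are [X n 1, ..., X n n]. *)
Definition norm_lp (R : realType) (p : R) (X : nat -> nat -> R) (n : nat)
    (f : R -> R) : R :=
  (n%:R^-1 * \sum_(1 <= k < n.+1) `|f (X n k)| `^ p) `^ p^-1.

(* [X n n.+1] is the first point of X_n shifted by the period. *)
Definition separated_nodes (R : realType) (gamma : R) (X : nat -> nat -> R) :
    Prop :=
  forall n, (0 < n)%N ->
    [/\ 0 <= X n 1%N,
        (forall k, (1 <= k < n)%N -> X n k < X n k.+1),
        X n n < 1,
        X n n.+1 = 1 + X n 1%N
      & (forall k, (1 <= k <= n)%N -> gamma / n%:R <= X n k.+1 - X n k)].

Definition difference (R : realType) (s : nat) (h : R) (f : R -> R) (x : R) : R :=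
  \sum_(0 <= nu < s.+1) 'C(s, nu)%:R * (-1) ^+ nu * f (x + (s - nu)%:R * h).

Definition modulus (R : realType) (s : nat) (f : R -> R) (delta p : R) : \bar R :=
  ereal_sup [set normLp p (difference s h f) | h in [set h | 0 < h < delta]].

Definition steklov (R : realType) (delta : R) (r : nat) (f : R -> R) (x : R) : R :=
  (-1) ^+ r.+1 * 'C(2 * r, r)%:R^-1 * (2 / delta) *
  \int[lambda]_(t in (`[- (delta / 2), delta / 2] : set (lebesgueR R)))
    \sum_(0 <= nu < r)
      (-1) ^+ nu * 'C(2 * r, nu)%:R * f (x + (r - nu)%:R / r%:R * t).

Definition Kfunctional (R : realType) (s : nat) (p : R) (X : nat -> nat -> R)
    (n : nat) (f : R -> R) : \bar R :=
  ereal_inf [set ((norm_lp p X n (f \- g)%R)%:E + normLp p (f \- g)%R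
                  + (n%:R ^- s)%:E * normLp p g^`(s)%classic)%E | g in Wsp s p].

(* Main.v *)
From HB Require Import structures.
Require Import Defs.
From mathcomp Require Import all_boot all_order all_algebra.
From mathcomp Require Import all_classical all_reals all_analysis.
From mathcomp Require Import measurable_realfun lebesgue_stieltjes_measure ring lra.

Set Implicit Arguments.
Unset Strict Implicit.
Unset Printing Implicit Defensive.
Import Order.TTheory GRing.Theory Num.Theory.
Import numFieldNormedType.Exports.
Local Open Scope classical_set_scope.
Local Open Scope ring_scope.

(** Why the theorem holds.  Write d = gamma / n, let f_d be the Steklov average
    of f, T the discrete norm of f_d - f, and B = omega_s(f, 1/n)_p.

    Three facts about f_d, valid at every point x, carry both inequalities.
    First, f_d(x) is dominated by a constant times the mean of |f| over the
    window [x - d/2, x + d/2] ([steklov_le]).  Second, if g lies in the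
    Sobolev class then g_d(x) - g(x) is, up to the factor (-1)^(r+1) / C(2r, r),
    the mean of the symmetric difference of order 2r of g, and, because s <= 2r,
    it is dominated by a constant times d^s times the mean of |g^(s)| over the same
    window ([steklov_sub_le]).
    Third, gamma is the separation constant of the nodes, so the windows around
    the n nodes do not overlap modulo 1; by convexity of the p-th power the
    discrete norm of a window mean of |w| is therefore at most a constant times
    the L_p norm of w ([norm_lp_average]).  Consequently
      discrete norm of w_d <= C |w|_p,
      discrete norm of g_d - g <= C n^-s |g^(s)|_p.

    Lower bound for K: given any g, the identity
    f_d - f = (f - g)_d + (g_d - g) - (f - g) bounds T, and
    |Delta_h^s f|_p <= 2^s |f - g|_p + s h^s |g^(s)|_p bounds B
    ([Kfunctional_lower]).

    Upper bound for K: a function g has to be produced with |f - g|_p and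
    n^-s |g^(s)|_p of size B.  If A_b is the moving average over [x, x + b],
    averaging v |-> Delta_v^s f(x) with the (s+1)-st power of A_a at v = 0 gives
    (-1)^s (f(x) - g(x)), where g is a combination of the (s+1)-fold averages
    of f of widths a, 2a, ..., sa ([smoothingE]).  Hence |f - g|_p is controlled
    by the differences of f, and differentiating an average turns it into a
    difference quotient, so g^(s) is a combination of
    b^-s Delta_b^s (A_b f) ([smoothing_derive]).  The discrete norm of f - g
    is then bounded through f - g = (f - f_d) + (f - g)_d + (g_d - g)
    ([Kfunctional_upper]).

    Two foundations are built on the way.  The L_p norms refer to Lebesgue
    measurable functions, whereas joint measurability, translations and
    the theorem of Tonelli are used for Borel functions: every periodic
    measurable f is replaced by a Borel periodic representative
    ([lebesgueR_borel_representative]), which changes no integral and hence,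
    for every x, does not change f_d(x).  And increments of an absolutely continuous
    function are bounded by the integral of the absolute value of its derivative
    ([abs_continuous_increment_le]), through the decomposition into monotone
    functions whose Stieltjes measures have Radon-Nikodym densities. *)

(** * Lebesgue and Borel measurability *)

Section bridge.
Context {R : realType}.
Notation mu := (@lebesgue_measure R).
Notation lam := (@completed_lebesgue_measure R).

(** A negligible set need not be Borel, so this relation tolerates an arbitrary
    Lebesgue measurable f on one side and a Borel g on the other. *)
Definition null_eq (T : Type) (f g : R -> T) :=
  mu.-negligible [set x | f x <> g x].

Lemma measurable_lebesgueR (A : set R) :
  measurable (A : set (measurableTypeR R)) -> measurable (A : set (lebesgueR R)).
Proof. exact: sub_caratheodory. Qed.

Lemma measurable_fun_lebesgueR d (T : measurableType d) (f : R -> T) :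
  measurable_fun setT f ->
  measurable_fun setT (f : lebesgueR R -> T).
Proof. by move=> mf _ B mB; apply: measurable_lebesgueR; exact: mf. Qed.

Lemma negligible_lebesgueR (N : set R) :
  mu.-negligible N -> lam.-negligible N.
Proof.
by move=> [A [mA A0 NA]]; exists A; split => //; exact: measurable_lebesgueR.
Qed.

(** The completed measure is carried to the Borel one by the identity map, so on
    Borel functions this is a change of variables along that map. *)
Lemma integral_lebesgueR (D : set R) (f : R -> \bar R) :
  measurable (D : set (measurableTypeR R)) ->
  measurable_fun setT f ->
  (\int[lam]_(x in D) f x = \int[mu]_(x in D) f x)%E.
Proof.
move=> mD mf.
have mid : measurable_fun setT (id : lebesgueR R -> measurableTypeR R).
  by move=> _ B mB; rewrite setTI preimage_id; exact: measurable_lebesgueR.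
have ge0case (F : R -> \bar R) : (forall x, 0 <= F x)%E ->
    measurable_fun setT F ->
    (\int[lam]_(x in D) F x = \int[mu]_(x in D) F x)%E.
  move=> F0 mF.
  have := @ge0_integral_pushforward _ _ (lebesgueR R) (measurableTypeR R) R id mid lam D F mD.
  rewrite preimage_id => <- //; last exact: measurable_funTS.
rewrite integralE [RHS]integralE; congr (_ - _)%E; apply: ge0case => //.
  exact: measurable_funepos.
exact: measurable_funeneg.
Qed.

(** Lets every integral of the statement, taken over the completed measure of a
    Lebesgue measurable function, be computed with Borel functions only. *)
Lemma integral_null_eq (D : set R) (f f0 : R -> \bar R) :
  measurable (D : set (measurableTypeR R)) ->
  measurable_fun setT f0 ->
  null_eq f f0 ->
  (\int[lam]_(x in D) f x = \int[mu]_(x in D) f0 x)%E.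
Proof.
move=> mD mf0 ff0; rewrite -integral_lebesgueR//.
have mD' := measurable_lebesgueR mD.
have mf0' : measurable_fun setT (f0 : lebesgueR R -> \bar R).
  exact: measurable_fun_lebesgueR.
have ae : ae_eq lam setT f0 f.
  apply: negligibleS (negligible_lebesgueR ff0) => x /=.
  by apply: contra_not => <-.
have mf : measurable_fun setT (f : lebesgueR R -> \bar R).
  by apply: (ae_measurable_fun _ ae) => //; exact: completed_lebesgue_measure_is_complete.
apply: ae_eq_integral => //.
- exact: measurable_funTS.
- exact: measurable_funTS.
- apply: negligibleS ae => x /=.
  by apply: contra_not => /(_ I) ->.
Qed.

End bridge.

(** * Affine changes of variable *)

Section affine.
Context {R : realType}.
Notation mu := (@lebesgue_measure R).
Implicit Types (c k : R) (A D : set R).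

Lemma measurable_affine c k : measurable_fun setT (fun t : R => c + k * t).
Proof. by apply: measurable_funD => //; exact: measurable_funM. Qed.

Definition affine_pushforward c k : {measure set (measurableTypeR R) -> \bar R} :=
  measure_function_pushforward__canonical__measure_function_Measure mu
    (measurable_affine c k :
      measurable_fun setT (fun t : measurableTypeR R => c + k * t : measurableTypeR R)).

(** By uniqueness of Lebesgue measure it is enough to compare both sides, which are
    measures in A, on half-open intervals. *)
Lemma lebesgue_measure_affine c k A : k != 0 -> measurable A ->
  (mu A = `|k|%:E * mu ((fun t => (c + k * t)%R) @^-1` A))%E.
Proof.
move=> k0 mA.
suff H X : ocitv X -> mu X = mscale (NngNum (normr_ge0 k)) (affine_pushforward c k) X.
  exact: (@lebesgue_measure_unique R
    (mscale (NngNum (normr_ge0 k)) (affine_pushforward c k)) H A mA).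
move=> /ocitvP[->|[[a b]/= ab ->]]; first by rewrite !measure0.
rewrite /mscale/= /pushforward.
have [k_gt0|k_le0] := ltP 0 k.
  rewrite (_ : _ @^-1` _ = `](a - c) / k, (b - c) / k]%classic); last first.
    apply/seteqP; split => t /=; rewrite !in_itv/= => /andP[];
      by rewrite ltr_pdivrMr// ler_pdivlMr// => ? ?; apply/andP; split; lra.
  rewrite !lebesgue_measure_itv/= !lte_fin ltr_pM2r ?invr_gt0// ltrD2r ab.
  rewrite -!EFinD -EFinM; congr EFin; rewrite gtr0_norm//.
  by field.
have k_lt0 : k < 0 by rewrite lt_neqAle k0.
rewrite (_ : _ @^-1` _ = `[(b - c) / k, (a - c) / k[%classic); last first.
  apply/seteqP; split => t /=; rewrite !in_itv/= => /andP[];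
    by rewrite ler_ndivrMr// ltr_ndivlMr// => ? ?; apply/andP; split; lra.
rewrite !lebesgue_measure_itv/= !lte_fin ltr_nM2r ?invr_lt0// ltrD2r ab.
rewrite -!EFinD -EFinM; congr EFin; rewrite ltr0_norm//.
by field.
Qed.

Lemma negligible_affine c k A : k != 0 -> mu.-negligible A ->
  mu.-negligible ((fun t => c + k * t) @^-1` A).
Proof.
move=> k0 [B [mB B0 AB]]; exists ((fun t => c + k * t) @^-1` B).
split; last by move=> x; exact: AB.
  by rewrite -[X in measurable X]setTI; exact: measurable_affine.
have := lebesgue_measure_affine c k0 mB; rewrite B0 => /esym/eqP.
by rewrite mule_eq0 eqe normr_eq0 (negbTE k0)/= => /eqP.
Qed.

Lemma ge0_integral_affine c k D (F : R -> \bar R) : k != 0 -> measurable D ->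
  measurable_fun setT F -> (forall x, 0 <= F x)%E ->
  (\int[mu]_(x in D) F x =
   `|k|%:E * \int[mu]_(t in (fun t => (c + k * t)%R) @^-1` D) F (c + k * t)%R)%E.
Proof.
move=> k0 mD mF F0.
have <- := @ge0_integral_pushforward _ _ (measurableTypeR R) (measurableTypeR R)
  R _ (measurable_affine c k) mu D F mD (measurable_funTS mF) (fun x _ => F0 x).
have /= := @ge0_integral_mscale _ _ _ (affine_pushforward c k) D mD
  (NngNum (normr_ge0 k)) F (measurable_funTS mF)
  (fun x _ => F0 x).
move=> <-; apply: eq_measure_integral => A mA AD.
exact: lebesgue_measure_affine.
Qed.

Lemma Rintegral_affine c k D (F : R -> R) : k != 0 -> measurable D ->
  measurable_fun setT F -> mu.-integrable D (EFin \o F) ->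
  \int[mu]_(x in D) F x =
   `|k| * \int[mu]_(t in (fun t => c + k * t) @^-1` D) F (c + k * t).
Proof.
move=> k0 mD mF intF.
have mF' : measurable_fun setT (EFin \o F) by exact/measurable_EFinP.
rewrite /Rintegral integralE.
rewrite (ge0_integral_affine c k0 mD (measurable_funepos mF'))//.
rewrite (ge0_integral_affine c k0 mD (measurable_funeneg mF'))//.
have k1 : (0 < `|k|) by rewrite normr_gt0.
have intFk : mu.-integrable ((fun t => c + k * t) @^-1` D) (fun t => (F (c + k * t))%:E).
  apply/integrableP; split.
    apply: measurable_funTS; apply/measurable_EFinP.
    exact: (measurableT_comp mF (measurable_affine c k)).
  move/integrableP : intF => [_].
  rewrite (ge0_integral_affine c k0 mD)//; last exact: measurableT_comp.
  rewrite -lte_pdivlMl// => /lt_le_trans; apply.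
  by rewrite leey.
have mpD : measurable ((fun t : R => c + k * t) @^-1` D).
  by rewrite -[X in measurable X]setTI; exact: measurable_affine.
rewrite [in RHS]integralE.
rewrite -[`|k| in RHS]/(fine `|k|%:E) -fineM//; last first.
  rewrite -integralE; exact: integrable_fin_num.
rewrite [in RHS]muleBr//; last first.
  by apply: fin_num_adde_defr; exact: integrable_pos_fin_num.
by congr (fine (_ * _ - _ * _)); apply: eq_integral => t _; rewrite ?funeposE ?funenegE.
Qed.

Lemma preimage_affine_itv c k a b : 0 < k ->
  (fun t => c + k * t) @^-1` `[c + k * a, c + k * b] = `[a, b]%classic.
Proof.
move=> k0; apply/seteqP; split => t /=; rewrite !in_itv/= !lerD2l !ler_pM2l//.
Qed.

End affine.

(** * Periodic Borel representatives *)

Section borel_representative.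
Context {R : realType}.
Notation mu := (@lebesgue_measure R).

Lemma negligible_bigcup_countType (T : countType) (N : T -> set R) :
  (forall q, mu.-negligible (N q)) -> mu.-negligible (\bigcup_(q in [set: T]) N q).
Proof.
move=> nN; rewrite (_ : \bigcup_(q in _) N q =
    \bigcup_n (if unpickle n is Some q then N q else set0)); last first.
  apply/seteqP; split=> [x [q _ Nx]|x [n _]].
    by exists (pickle q); rewrite ?pickleK.
  by case: (unpickle n) => // q Nq; exists q.
apply: negligible_bigcup => n; case: (unpickle n) => [q|]; first exact: nN.
exact: negligible_set0.
Qed.

(** The Caratheodory sigma-algebra is the completion of the Borel one. *)
Lemma lebesgueR_measurableP (A : set R) : measurable (A : set (lebesgueR R)) ->
  exists B N, [/\ measurable (B : set (measurableTypeR R)),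
    mu.-negligible N & A = B `|` N].
Proof.
move=> mA.
have : (completed_algebra_gen mu).-sigma.-measurable A.
  by rewrite completed_caratheodory_measurable.
rewrite g_sigma_completed_algebra_genE => -[B mB [N nN BN]].
by exists B, N.
Qed.

(** The union of all integer translates of a Borel null set that contains N. *)
Lemma negligible_periodic_hull (N : set R) : mu.-negligible N ->
  exists M, [/\ measurable (M : set (measurableTypeR R)), mu M = 0%E, N `<=` M &
    forall x, M (x + 1) <-> M x].
Proof.
move=> [B [mB B0 NB]].
pose T (k : int) := (fun t : R => k%:~R + 1 * t) @^-1` B.
have mT k : measurable (T k).
  by rewrite -[X in measurable X]setTI; exact: measurable_affine.
have nT k : mu.-negligible (T k).
  by apply: negligible_affine; [exact: oner_neq0|exists B; split].
pose M := \bigcup_(n : nat) (T n%:Z `|` T (- n%:Z)).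
have ME x : M x <-> exists k : int, B (x + k%:~R).
  split=> [[n _ [Tn|Tn]]|[[n|n] Bn]].
  - by exists n%:Z; move: Tn; rewrite /T/= mul1r addrC.
  - by exists (- n%:Z); move: Tn; rewrite /T/= mul1r addrC.
  - by exists n => //; left; rewrite /T/= mul1r addrC.
  - by exists n.+1 => //; right; rewrite /T/= mul1r addrC -NegzE.
have mM : measurable M.
  by apply: bigcupT_measurable => n; apply: measurableU; exact: mT.
exists M; split.
- exact: mM.
- apply/negligibleP; first exact: mM.
  by apply: negligible_bigcup => n; exact: negligibleU.
- by move=> x /NB Bx; apply/ME; exists 0; rewrite addr0.
- move=> x; split => /ME[k Bk]; apply/ME.
    by exists (1 + k); rewrite intrD addrA.
  by exists (k - 1); rewrite intrB; move: Bk; congr (B _); ring.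
Qed.

(** Each superlevel set of f at a rational height is Borel up to a null set.
    There are countably many of these null sets; setting f to 0 on a periodic
    Borel null set that contains them all makes every superlevel set Borel, and
    the invariance of that null set keeps the function periodic. *)
Lemma lebesgueR_borel_representative (f : R -> R) :
  periodic f 1 -> measurable_fun [set: lebesgueR R] (f : lebesgueR R -> R) ->
  exists f0 : R -> R, [/\ measurable_fun setT f0, periodic f0 1 & null_eq f f0].
Proof.
move=> pf mf.
have mgt (q : rat) : measurable ([set x | ratr q < f x] : set (lebesgueR R)).
  have := mf measurableT _ (measurable_itv `]ratr q, +oo[); rewrite setTI.
  congr (measurable _); apply/seteqP; split => x /=; by rewrite in_itv/= andbT.
have /choice[B HB] (q : rat) := lebesgueR_measurableP (mgt q).
have /choice[N HN] (q : rat) := HB q.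
have nN : mu.-negligible (\bigcup_(q in [set: rat]) N q).
  by apply: negligible_bigcup_countType => q; have [] := HN q.
have [M [mM M0 NM Mp]] := negligible_periodic_hull nN.
pose f0 x := if x \in M then 0 else f x.
exists f0; split.
- apply: (measurability _ (RGenOInfty.measurableE R)) => _ [_ [y ->] <-].
  rewrite setTI.
  have -> : f0 @^-1` `]y, +oo[ =
     \bigcup_(q in [set q : rat | y < ratr q])
       ((B q `\` M) `|` (if (ratr q : R) < 0 then M else set0)).
    apply/seteqP; split => x /=.
      rewrite in_itv/= andbT => yx.
      have [q] := rat_in_itvoo yx; rewrite in_itv/= => /andP[yq qx].
      exists q => //; rewrite /f0 in qx.
      case: ifPn qx => [/set_mem xM q0|/negP xM qx]; first by right; rewrite q0.
      left; have [_ _ E] := HN q.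
      have : [set x | ratr q < f x] x by [].
      rewrite E => -[Bx|Nx]; first by split => // /mem_set.
      by exfalso; apply/xM/mem_set/NM; exists q.
    move=> [q /= yq H]; rewrite in_itv/= andbT; apply: (lt_trans yq); rewrite /f0.
    case: H => [[Bx Mx]|].
      rewrite ifF; last by apply/negbTE/negP => /set_mem.
      have [_ _ E] := HN q.
      by have : [set x | ratr q < f x] x by rewrite E; left.
    by case: ifPn => // q0 Mx; rewrite mem_set.
  rewrite bigcup_mkcond; apply: bigcupT_measurable_rat => q.
  case: ifPn => // _; apply: measurableU; last by case: ifPn.
  by apply: measurableD => //; have [] := HN q.
- move=> x; rewrite /f0 pf.
  have -> : (x + 1 \in M) = (x \in M) by apply/idP/idP => /set_mem /Mp /mem_set.
  by [].
- exists M; split => // x /= ; rewrite /f0; case: ifPn => // /set_mem //.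
Qed.

End borel_representative.

(** * Equality almost everywhere *)

Section null_eq_theory.
Context {R : realType}.
Notation mu := (@lebesgue_measure R).

Lemma null_eq_refl (T : Type) (f : R -> T) : null_eq f f.
Proof. by exists set0; split => // x /=; apply. Qed.

Lemma null_eq_comp (T U : Type) (F : T -> U) (f g : R -> T) :
  null_eq f g -> null_eq (F \o f) (F \o g).
Proof. by apply: negligibleS => x /=; apply: contra_not => ->. Qed.

Lemma null_eq_comp2 (T U V : Type) (F : T -> U -> V) f g f' g' :
  null_eq f f' -> null_eq g g' ->
  null_eq (fun x : R => F (f x) (g x)) (fun x => F (f' x) (g' x)).
Proof.
move=> ff' gg'; apply: negligibleS (negligibleU ff' gg') => x /= FN.
by apply/not_andP => -[ffx ggx]; apply: FN; rewrite ffx ggx.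
Qed.

Lemma null_eq_affine (T : Type) (f g : R -> T) c k : k != 0 ->
  null_eq f g -> null_eq (fun t => f (c + k * t)) (fun t => g (c + k * t)).
Proof. by move=> k0; exact: negligible_affine. Qed.

Lemma null_eq_sum (I : Type) (r : seq I) (F G : I -> R -> R) :
  (forall i, null_eq (F i) (G i)) ->
  null_eq (fun x => \sum_(i <- r) F i x) (fun x => \sum_(i <- r) G i x).
Proof.
move=> FG; elim: r => [|i r IHr].
  by under eq_fun do rewrite big_nil; under [X in null_eq _ X]eq_fun do rewrite big_nil;
     exact: null_eq_refl.
under eq_fun do rewrite big_cons; under [X in null_eq _ X]eq_fun do rewrite big_cons.
exact: null_eq_comp2.
Qed.

Lemma Rintegral_null_eq (D : set R) (f f0 : R -> R) :
  measurable (D : set (measurableTypeR R)) -> measurable_fun setT f0 ->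
  null_eq f f0 ->
  \int[@completed_lebesgue_measure R]_(x in D) f x = \int[mu]_(x in D) f0 x.
Proof.
move=> mD mf0 ff0; rewrite /Rintegral; congr fine.
apply: integral_null_eq => //; first exact/measurable_EFinP.
exact: (null_eq_comp (@EFin R)).
Qed.

End null_eq_theory.

(** * Integrals of periodic functions *)

Section periodic_integral.
Context {R : realType}.
Notation mu := (@lebesgue_measure R).
Implicit Types (F : R -> \bar R) (a b c : R).

Lemma ge0_integral_itv_cat F a b c : measurable_fun setT F ->
  (forall x, 0 <= F x)%E -> a <= b -> b <= c ->
  (\int[mu]_(x in `[a, c[) F x =
   \int[mu]_(x in `[a, b[) F x + \int[mu]_(x in `[b, c[) F x)%E.
Proof.
move=> mF F0 ab bc.
rewrite (@itv_bndbnd_setU _ _ (BLeft a) (BLeft b) (BLeft c)) ?bnd_simp//.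
rewrite ge0_integral_setU//; first exact: measurable_funTS.
apply/disj_setPS => y [/=]; rewrite !in_itv/= => /andP[_ yx] /andP[].
by rewrite leNgt yx.
Qed.

Lemma ge0_integral_itv_shift F a b c : measurable_fun setT F ->
  (forall x, 0 <= F x)%E ->
  (\int[mu]_(x in `[(c + a)%R, (c + b)%R[) F x = \int[mu]_(x in `[a, b[) F (c + x)%R)%E.
Proof.
move=> mF F0; rewrite (ge0_integral_affine c (oner_neq0 R))// normr1 mul1e.
rewrite (_ : _ @^-1` _ = `[a, b[%classic); last first.
  by apply/seteqP; split => x /=; rewrite !in_itv/= mul1r !lerD2l !ltrD2l.
by apply: eq_integral => x _; rewrite mul1r.
Qed.

Lemma ge0_integral_periodic_shift F a b c : measurable_fun setT F ->
  (forall x, 0 <= F x)%E -> (forall x, F (x + c)%R = F x) ->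
  (\int[mu]_(x in `[(a + c)%R, (b + c)%R[) F x = \int[mu]_(x in `[a, b[) F x)%E.
Proof.
move=> mF F0 pF; rewrite ![_ + c]addrC ge0_integral_itv_shift//.
by apply: eq_integral => x _; rewrite addrC pF.
Qed.

Lemma periodic_int (T : Type) (F : R -> T) (k : int) :
  (forall x, F (x + 1)%R = F x) -> forall x, F (x + k%:~R)%R = F x.
Proof.
move=> pF.
have pn (n : nat) x : F (x + n%:R) = F x.
  by elim: n x => [|n IHn] x; rewrite ?addr0// -natr1 addrA pF IHn.
move=> x; case: k => n; first exact: pn.
by rewrite NegzE mulrNz -[LHS](pn n.+1) subrK.
Qed.

(** With m the integer such that m <= c < m + 1, the piece [m + 1, c + 1[ is moved
    back by one period onto [m, c[. *)
Lemma ge0_integral_period F c : measurable_fun setT F ->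
  (forall x, 0 <= F x)%E -> (forall x, F (x + 1)%R = F x) ->
  (\int[mu]_(x in `[c, (c + 1)%R[) F x = \int[mu]_(x in `[0%R, 1%R[) F x)%E.
Proof.
move=> mF F0 pF.
pose m : R := (Num.floor c)%:~R.
have mc : m <= c by exact: Num.Theory.floor_le_tmp.
have cm : c <= m + 1 by rewrite ltW// -intrD1 Num.Theory.floorD1_gt.
rewrite (@ge0_integral_itv_cat _ c (m + 1))//; last lra.
rewrite [X in (_ + X)%E]ge0_integral_periodic_shift// addeC.
rewrite -ge0_integral_itv_cat//.
rewrite -(@ge0_integral_periodic_shift F 0 1 m)//; last exact: periodic_int.
by rewrite add0r addrC.
Qed.

Lemma ge0_integral_period_lty F a b : measurable_fun setT F ->
  (forall x, 0 <= F x)%E -> (forall x, F (x + 1)%R = F x) ->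
  (\int[mu]_(x in `[0%R, 1%R[) F x < +oo)%E -> (\int[mu]_(x in `[a, b]) F x < +oo)%E.
Proof.
move=> mF F0 pF Foo.
have H (n : nat) : (\int[mu]_(x in `[a, (a + n%:R)%R[) F x < +oo)%E.
  elim: n => [|n IHn].
    by rewrite addr0 set_itv_ge ?bnd_simp ?ltxx// integral_set0.
  rewrite (@ge0_integral_itv_cat _ _ (a + n%:R))// ?lerDl//; last first.
    by rewrite lerD2l ler_nat.
  apply: lte_add_pinfty => //.
  have -> : a + n.+1%:R = (a + n%:R) + 1 by rewrite -natr1 addrA.
  by rewrite ge0_integral_period.
pose n := (Num.truncn `|b - a|).+1.
apply: le_lt_trans (H n); apply: ge0_subset_integral => //; first exact: measurable_funTS.
move=> x /=; rewrite !in_itv/= => /andP[-> xb]/=.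
rewrite (le_lt_trans xb)// -ltrBlDl (le_lt_trans (ler_norm _))//.
exact: Num.Theory.truncnS_gt.
Qed.

End periodic_integral.

(** * The norm over one period *)

Section period_norm.
Context {R : realType}.
Notation mu := (@lebesgue_measure R).
Implicit Types (p : R) (f g : R -> R).

(** [normLp] with the Borel sigma-algebra in place of the Lebesgue one. *)
Definition period_norm p f : \bar R :=
  ('N[mu]_(p%:E)[EFin \o (f \_ `[0, 1[%classic : R -> R)%R])%E.

Definition loc_integrable f :=
  measurable_fun setT f /\ forall a b, mu.-integrable `[a, b] (EFin \o f).

Lemma period_normE p f : p != 0 ->
  period_norm p f =
  ((\int[mu]_(x in `[0%R, 1%R[) (`|f x| `^ p)%:E) `^ p^-1)%E.
Proof.
move=> p0; rewrite /period_norm unlock /Lnorm.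
apply: (f_equal (fun I => poweR I p^-1)).
rewrite [RHS]integral_mkcond; apply: eq_integral => x _ /=.
by rewrite /patch; case: ifPn => // _; rewrite normr0 powR0.
Qed.

(** The passage from the Lebesgue measurable setting to Borel representatives; all
    norm estimates below are proved for [period_norm]. *)
Lemma normLp_period_norm p f f0 : p != 0 -> measurable_fun setT f0 ->
  null_eq f f0 -> normLp p f = period_norm p f0.
Proof.
move=> p0 mf0 ff0; rewrite /normLp /period_norm unlock /Lnorm.
congr (poweR _ _).
pose F g x : \bar R := (`| (EFin \o (g \_ `[0%R, 1%R[ : R -> R)) x | `^ p)%E.
have mF0 : measurable_fun setT (F f0).
  apply/measurable_EFinP; apply: (measurableT_comp (measurable_powR p)).
  apply: measurableT_comp => //.
  by apply: (measurable_restrictT _ _).1 => //; exact: measurable_funTS.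
have nF : null_eq (F f) (F f0).
  by apply: negligibleS ff0 => x /=; apply: contra_not => fx; rewrite /F /= /patch fx.
have E := @integral_null_eq R setT (F f) (F f0) measurableT mF0 nF.
exact: E.
Qed.

Lemma measurable_abs_powR p f : measurable_fun setT f ->
  measurable_fun setT (fun x => (`|f x| `^ p)%:E).
Proof.
move=> mf; apply/measurable_EFinP; apply: (measurableT_comp (measurable_powR p)).
exact: measurableT_comp.
Qed.

(** A finite norm over one period gives integrability on bounded intervals through
    |f| <= 1 + |f|^p. *)
Lemma period_norm_loc_integrable p f : 1 <= p -> measurable_fun setT f ->
  periodic f 1 -> (period_norm p f < +oo)%E -> loc_integrable f.
Proof.
move=> p1 mf pf; have p0 : p != 0 by rewrite gt_eqF// (lt_le_trans ltr01).
rewrite period_normE// => /lty_poweRy; rewrite invr_eq0 => /(_ p0) foo.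
split => // a b; apply/integrableP; split.
  by apply: measurable_funTS; exact/measurable_EFinP.
apply: (@le_lt_trans _ _ (\int[mu]_(x in `[a, b]) (1 + (`|f x| `^ p)%:E))%E).
  apply: ge0_le_integral => //.
  - by apply: measurable_funTS; apply: measurableT_comp => //; exact/measurable_EFinP.
  - apply: emeasurable_funD => //; apply: measurable_funTS; exact: measurable_abs_powR.
  move=> x _ /=; rewrite -EFinD lee_fin.
  have [fx1|fx1] := leP `|f x| 1; first by rewrite (le_trans fx1)// lerDl powR_ge0.
  rewrite (@le_trans _ _ (`|f x| `^ p))// ?lerDr//.
  by rewrite le1r_powR// ltW.
rewrite ge0_integralD//; last first.
  by apply: measurable_funTS; exact: measurable_abs_powR.
rewrite lte_add_pinfty//.
  by rewrite integral_cst//= mul1e lebesgue_measure_itv/=; case: ifP; rewrite ?ltry.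
apply: ge0_integral_period_lty => //; first exact: measurable_abs_powR.
by move=> x; rewrite pf.
Qed.

End period_norm.

(** * Convexity of the power function *)

Section jensen.
Context {R : realType}.
Notation mu := (@lebesgue_measure R).
Implicit Types (p : R).

(** The tangent line at m to the convex function y^p lies below its graph; this is
    the inequality of Young applied to y and m^(p - 1). *)
Lemma powR_tangent p (y m : R) : 1 <= p -> 0 <= y -> 0 <= m ->
  p * m `^ (p - 1) * y <= y `^ p + (p - 1) * m `^ p.
Proof.
move=> p1 y0 m0; have p0 : 0 < p by rewrite (lt_le_trans ltr01).
have [->|pN1] := eqVneq p 1.
  by rewrite subrr powRr0 mul1r mul1r mul0r addr0 powRr1.
have p1' : 0 < p - 1 by rewrite subr_gt0 lt_neqAle eq_sym pN1.
have pq : p^-1 + (p / (p - 1))^-1 = 1 by field; rewrite !gt_eqF.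
(* The conjugate exponent of p is p / (p - 1). *)
have := conjugate_powR y0 (powR_ge0 m (p - 1)) p0 (divr_gt0 p0 p1') pq.
rewrite -powRrM mulrCA mulfV ?gt_eqF// mulr1 -(ler_pM2l p0).
move=> /le_trans-/(_ (y `^ p + (p - 1) * m `^ p)).
rewrite -mulrA [m `^ _ * y]mulrC; apply.
rewrite le_eqVlt; apply/orP; left; apply/eqP; field.
by rewrite !gt_eqF.
Qed.

(** The inequality of Jensen: the tangent line inequality at the mean value,
    integrated over [a, b]. *)
Lemma powR_average_le p (a b : R) (u : R -> R) : 1 <= p -> a < b ->
  measurable_fun setT u -> mu.-integrable `[a, b] (EFin \o u) ->
  ((((b - a)^-1 * \int[mu]_(t in `[a, b]) `|u t|) `^ p)%:E <=
   ((b - a)^-1)%:E * \int[mu]_(t in `[a, b]) (`|u t| `^ p)%:E)%E.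
Proof.
move=> p1 ab mu_ iu; set m := _ * _; set J := (\int[_]_(_ in _) (_ `^ _)%:E)%E.
have p0 : 0 < p by rewrite (lt_le_trans ltr01).
have ba : 0 < b - a by rewrite subr_gt0.
have I0 : 0 <= \int[mu]_(t in `[a, b]) `|u t| by exact: Rintegral_ge0.
have m0 : 0 <= m by rewrite mulr_ge0// invr_ge0 ltW.
have IE : (\int[mu]_(t in `[a, b]) `|u t|%:E = ((b - a) * m)%:E)%E.
  rewrite /m mulVKf ?gt_eqF// /Rintegral fineK//.
  by apply: integrable_fin_num => //; exact: integrable_abse iu.
have mabs : measurable_fun `[a, b] (fun t => `|u t|%:E).
  by apply: measurable_funTS; apply/measurable_EFinP; exact: measurableT_comp.
have mp : measurable_fun `[a, b] (fun t => (`|u t| `^ p)%:E).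
  by apply: measurable_funTS; exact: measurable_abs_powR.
have L : mu `[a, b] = (b - a)%:E by rewrite lebesgue_measure_itv/= lte_fin ab.
have : (\int[mu]_(t in `[a, b]) ((p * m `^ (p - 1))%:E * `|u t|%:E) <=
    \int[mu]_(t in `[a, b]) ((`|u t| `^ p)%:E + ((p - 1) * m `^ p)%:E))%E.
  apply: ge0_le_integral => //.
  - by move=> t _; rewrite -EFinM lee_fin !mulr_ge0// ?powR_ge0// ltW.
  - exact: emeasurable_funM.
  - exact: emeasurable_funD.
  - by move=> t _; rewrite -EFinM -EFinD lee_fin powR_tangent.
have c0 : 0 <= (p - 1) * m `^ p by rewrite mulr_ge0 ?powR_ge0// subr_ge0.
rewrite ge0_integralZl_EFin//; last by rewrite mulr_ge0 ?powR_ge0// ltW.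
rewrite ge0_integralD//.
rewrite integral_cst//= L IE -/J -!EFinM -leeBlDr// -EFinB.
move=> H; rewrite lee_pdivlMl// -EFinM.
apply: le_trans H; rewrite lee_fin.
rewrite -(mulr_powRB1 m0 p0).
rewrite le_eqVlt; apply/orP; left; apply/eqP; ring.
Qed.

End jensen.

(** * Norms of averages *)

Section average_norm.
Context {R : realType}.
Notation mu := (@lebesgue_measure R).
Implicit Types (p : R).

Lemma measurable_section1 d (T : measurableType d) (F : R -> R -> T) x :
  measurable_fun setT (fun z : R * R => F z.1 z.2) -> measurable_fun setT (F x).
Proof. by move=> mF; exact: (measurableT_comp mF (pair1_measurable x)). Qed.

Lemma measurable_integral_section (B : set R) (F : R -> R -> \bar R) :
  measurable B ->
  measurable_fun setT (fun z : R * R => F z.1 z.2) -> (forall x y, 0 <= F x y)%E ->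
  measurable_fun setT (fun x => \int[mu]_(y in B) F x y)%E.
Proof.
move=> mB mF F0.
pose G (z : R * R) := (F z.1 z.2 * (\1_B z.2)%:E)%E.
have mG : measurable_fun setT G.
  apply: emeasurable_funM => //; apply/measurable_EFinP.
  exact: measurableT_comp.
have G0 z : (0 <= G z)%E by rewrite /G mule_ge0// lee_fin.
have := @measurable_fun_fubini_tonelli_F _ _ _ _ R mu G mG G0.
congr measurable_fun; apply/funext => x; rewrite /fubini_F [RHS]integral_mkcond.
apply: eq_integral => y _; rewrite /G /= /patch indicE.
by case: (y \in B); rewrite ?mule1 ?mule0.
Qed.

Lemma tonelli_rect (A B : set R) (F : R -> R -> \bar R) :
  measurable A -> measurable B ->
  measurable_fun setT (fun z : R * R => F z.1 z.2) -> (forall x y, 0 <= F x y)%E ->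
  (\int[mu]_(x in A) \int[mu]_(y in B) F x y =
   \int[mu]_(y in B) \int[mu]_(x in A) F x y)%E.
Proof.
move=> mA mB mF F0.
pose G (z : R * R) := (F z.1 z.2 * (\1_A z.1)%:E * (\1_B z.2)%:E)%E.
have mG : measurable_fun setT G.
  apply: emeasurable_funM; first apply: emeasurable_funM => //.
    by apply/measurable_EFinP; apply: measurableT_comp.
  by apply/measurable_EFinP; apply: measurableT_comp.
have G0 z : (0 <= G z)%E by rewrite /G !mule_ge0// lee_fin.
have := @fubini_tonelli _ _ _ _ R mu mu G mG G0.
rewrite (_ : (\int[mu]_x \int[mu]_y G (x, y) =
    \int[mu]_(x in A) \int[mu]_(y in B) F x y)%E); last first.
  rewrite [RHS]integral_mkcond; apply: eq_integral => x _.
  rewrite /patch; case: ifPn => xA.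
    rewrite [RHS]integral_mkcond; apply: eq_integral => y _.
    rewrite /G /= !indicE xA mule1 /patch.
    by case: (y \in B); rewrite ?mule1 ?mule0.
  by apply: integral0_eq => y _; rewrite /G /= !indicE (negbTE xA) mule0 mul0e.
move=> ->.
rewrite [RHS]integral_mkcond; apply: eq_integral => y _.
rewrite /patch; case: ifPn => yB.
  rewrite [RHS]integral_mkcond; apply: eq_integral => x _.
  rewrite /G /= !indicE yB mule1 /patch.
  by case: (x \in A); rewrite ?mule1 ?mule0.
by apply: integral0_eq => x _; rewrite /G /= !indicE (negbTE yB) mule0.
Qed.

(** Removes the exponent 1/p, so that norm bounds become bounds of integrals. *)
Lemma period_norm_le p f B : 1 <= p -> (0 <= B)%E ->
  (period_norm p f <= B)%E <->
  (\int[mu]_(x in `[0%R, 1%R[) (`|f x| `^ p)%:E <= B `^ p)%E.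
Proof.
move=> p1 B0; have p0 : 0 < p by rewrite (lt_le_trans ltr01).
have pN0 : p != 0 by rewrite gt_eqF.
rewrite period_normE//; set I := (\int[_]_(_ in _) _)%E.
have I0 : (0 <= I)%E by apply: integral_ge0 => x _; rewrite lee_fin powR_ge0.
split=> H.
  rewrite -(@poweRe1 _ I)// -(mulVf pN0) poweRrM.
  by rewrite gt0_ler_poweR ?(ltW p0)// in_itv/= ?poweR_ge0 ?leey ?B0.
rewrite -(@poweRe1 _ B)// -(mulfV pN0) poweRrM.
by rewrite gt0_ler_poweR ?invr_ge0 ?(ltW p0)// in_itv/= ?poweR_ge0 ?leey ?I0.
Qed.

(** The integral inequality of Minkowski in the form needed below: a function that
    is dominated by an average over t of the functions u(., t) is bounded in norm
    by any common bound of their norms.  Jensen is applied for each x, then the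
    integrals in x and t are exchanged. *)
Lemma period_norm_average (p h : R) (u : R -> R -> R) (w : R -> R) (B : \bar R) :
  1 <= p -> 0 < h -> (0 <= B)%E ->
  measurable_fun setT (fun z : R * R => u z.1 z.2) -> measurable_fun setT w ->
  (forall x, mu.-integrable `[0, h] (EFin \o u x)) ->
  (forall x, `|w x| <= h^-1 * \int[mu]_(t in `[0, h]) `|u x t|) ->
  (forall t, 0 < t <= h -> (period_norm p (u^~ t) <= B)%E) ->
  (period_norm p w <= B)%E.
Proof.
move=> p1 h0 B0 mu_ mw iu wu uB.
have p0 : 0 < p by rewrite (lt_le_trans ltr01).
apply/(period_norm_le _ p1 B0).
have mup : measurable_fun setT (fun z : R * R => (`|u z.1 z.2| `^ p)%:E).
  apply/measurable_EFinP; apply: (measurableT_comp (measurable_powR p)).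
  exact: measurableT_comp.
have mux x := measurable_section1 x mu_.
have mup0 x t : (0 <= (`|u x t| `^ p)%:E)%E by rewrite lee_fin powR_ge0.
have ms : measurable_fun setT (fun z : R * R => (z.2, z.1)).
  by apply: measurable_fun_pair; [exact: measurable_snd|exact: measurable_fst].
have mups : measurable_fun setT (fun z : R * R => (`|u z.2 z.1| `^ p)%:E).
  exact: (measurableT_comp mup ms).
have mJ : measurable_fun setT (fun x => \int[mu]_(t in `[0%R, h]) (`|u x t| `^ p)%:E)%E.
  exact: (@measurable_integral_section _ (fun x t => (`|u x t| `^ p)%:E)).
apply: (@le_trans _ _ (\int[mu]_(x in `[0%R, 1%R[)
   ((h^-1)%:E * \int[mu]_(t in `[0%R, h]) (`|u x t| `^ p)%:E))%E).
  apply: ge0_le_integral => //.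
  - by apply: measurable_funTS; exact: measurable_abs_powR.
  - by apply: measurable_funTS; apply: emeasurable_funM.
  move=> x _; apply: (@le_trans _ _
      ((h^-1 * \int[mu]_(t in `[0, h]) `|u x t|) `^ p)%:E).
    rewrite lee_fin ge0_ler_powR ?nnegrE ?(ltW p0)//.
    by rewrite mulr_ge0 ?invr_ge0 ?(ltW h0)// Rintegral_ge0.
  have := @powR_average_le R p 0 h (u x) p1 h0 (mux x) (iu x).
  by rewrite subr0.
rewrite ge0_integralZl_EFin//; last 3 first.
- by move=> x _; apply: integral_ge0.
- exact: measurable_funTS.
- by rewrite invr_ge0 ltW.
rewrite (@tonelli_rect _ _ (fun x t => (`|u x t| `^ p)%:E))// lee_pdivrMl//.
(* The hypothesis on the sections is for t > 0 only: a difference of step 0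
   is not covered by the modulus of smoothness. *)
rewrite -integral_itv_obnd_cbnd; last first.
  apply: measurable_funTS.
  exact: (@measurable_integral_section _ (fun t x => (`|u x t| `^ p)%:E)).
have muh : mu `]0%R, h] = h%:E by rewrite lebesgue_measure_itv/= lte_fin h0 -EFinB subr0.
apply: (@le_trans _ _ (\int[mu]_(t in `]0%R, h]) (cst (B `^ p) t))%E).
  apply: ge0_le_integral => //.
  - by move=> t _; apply: integral_ge0.
  - apply: measurable_funTS.
    exact: (@measurable_integral_section _ (fun t x => (`|u x t| `^ p)%:E)).
  move=> t; rewrite /= in_itv/= => t0h.
  by apply/(period_norm_le _ p1 B0); exact: uB.
by rewrite integral_cst//= muh muleC.
Qed.

End average_norm.

(** * Translation and triangle inequalities for the norm *)

Section period_norm_theory.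
Context {R : realType}.
Notation mu := (@lebesgue_measure R).
Implicit Types (p c : R) (f g : R -> R).

Lemma period_norm_ge0 p f : (0 <= period_norm p f)%E.
Proof. exact: Lnorm_ge0. Qed.

Lemma eq_period_norm p f g : f =1 g -> period_norm p f = period_norm p g.
Proof. by move=> /funext ->. Qed.

Lemma period_normD p f g : 1 <= p -> measurable_fun setT f -> measurable_fun setT g ->
  (period_norm p (f \+ g)%R <= period_norm p f + period_norm p g)%E.
Proof.
move=> p1 mf mg; rewrite /period_norm.
rewrite (_ : (f \+ g) \_ `[0, 1[ = (f \_ `[0, 1[) \+ (g \_ `[0, 1[)); last first.
  by apply/funext => x; rewrite /patch /=; case: ifPn => //; rewrite addr0.
by apply: minkowski_EFin => //; apply: (measurable_restrictT _ _).1 => //;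
  exact: measurable_funTS.
Qed.

Lemma period_normZ p c f : 1 <= p -> measurable_fun setT f ->
  (period_norm p (fun x => c * f x)%R = `|c|%:E * period_norm p f)%E.
Proof.
move=> p1 mf; have p0 : 0 < p by rewrite (lt_le_trans ltr01).
have pN0 : p != 0 by rewrite gt_eqF.
rewrite !period_normE//.
under eq_integral do rewrite normrM powRM// EFinM.
rewrite ge0_integralZl_EFin//; last first.
  by apply: measurable_funTS; exact: measurable_abs_powR.
rewrite poweRM//; last first.
  by apply: integral_ge0 => x _; rewrite lee_fin powR_ge0.
by rewrite poweR_EFin -powRrM mulfV// powRr1.
Qed.

Lemma period_norm0 p : p != 0 -> period_norm p (fun=> 0) = 0%E.
Proof.
move=> p0; rewrite period_normE//.
under eq_integral do rewrite normr0 powR0//.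
by rewrite integral0 poweR0r// invr_eq0.
Qed.

Lemma period_norm_sum p (I : Type) (r : seq I) (c : I -> R) (F : I -> R -> R) :
  1 <= p -> (forall i, measurable_fun setT (F i)) ->
  (period_norm p (fun x => \sum_(i <- r) c i * F i x)%R <=
   \sum_(i <- r) `|c i|%:E * period_norm p (F i))%E.
Proof.
move=> p1 mF; have p0 : 0 < p by rewrite (lt_le_trans ltr01).
elim: r => [|i r IHr].
  under eq_period_norm do rewrite big_nil.
  by rewrite big_nil period_norm0// gt_eqF.
rewrite (_ : (fun x => _) = (fun x => c i * F i x) \+
    (fun x => \sum_(j <- r) c j * F j x)); last first.
  by apply/funext => x; rewrite big_cons.
rewrite big_cons.
apply: (le_trans (period_normD p1 _ _)).
- exact: measurable_funM.
- by apply: measurable_sum => j; exact: measurable_funM.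
by rewrite period_normZ// leeD2l.
Qed.

Lemma period_norm_shift p c f : 1 <= p -> measurable_fun setT f -> periodic f 1 ->
  period_norm p (fun x => f (x + c)) = period_norm p f.
Proof.
move=> p1 mf pf; have p0 : 0 < p by rewrite (lt_le_trans ltr01).
have pN0 : p != 0 by rewrite gt_eqF.
rewrite (period_normE _ pN0) [RHS](period_normE _ pN0).
apply: (f_equal (fun I => poweR I p^-1)).
have m := measurable_abs_powR p mf.
have F0 x : (0 <= (`|f x| `^ p)%:E)%E by rewrite lee_fin powR_ge0.
rewrite -(ge0_integral_period c m F0); last by move=> x; rewrite pf.
have := ge0_integral_itv_shift 0 1 c m F0; rewrite addr0 => ->.
by apply: eq_integral => x _; rewrite addrC.
Qed.

End period_norm_theory.

(** * Families of intervals and total variation *)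

Section nonoverlapping.
Context {R : realType}.
Implicit Types (a b d e : R) (f : R -> R) (I J : R * R) (L : seq (R * R)).

Definition nonoverlapping I J := (I.2 <= J.1) || (J.2 <= I.1).

(** Lists allow a family to be refined one interval at a time, which indexed
    families of a varying size do not. *)
Definition interval_family a b L :=
  all (fun I => [&& a <= I.1, I.1 <= I.2 & I.2 <= b]) L && pairwise nonoverlapping L.

Definition total_length L := \sum_(I <- L) (I.2 - I.1).

Lemma nonoverlappingC I J : nonoverlapping I J = nonoverlapping J I.
Proof. by rewrite /nonoverlapping orbC. Qed.

Lemma nonoverlapping_disjoint I J : nonoverlapping I J ->
  `]I.1, I.2[%classic `&` `]J.1, J.2[ = set0.
Proof.
move=> IJ; apply/seteqP; split => // x [] /=; rewrite !in_itv/= => /andP[Ix xI] /andP[Jx xJ].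
by case/orP: IJ => ?; lra.
Qed.

Lemma abs_continuous_family a b f : abs_continuous_on a b f ->
  forall e, 0 < e -> exists2 d, 0 < d & forall L, interval_family a b L ->
    total_length L < d -> \sum_(I <- L) `|f I.2 - f I.1| < e.
Proof.
move=> acf e e0; have [d d0 H] := acf e e0; exists d => // L /andP[/allP aL pL] Ld.
pose u (i : 'I_(size L)) := (nth (a, a) L i).1.
pose v (i : 'I_(size L)) := (nth (a, a) L i).2.
have := H _ u v; rewrite (big_nth (a, a)) big_mkord; apply.
- by move=> i; have /and3P[] := aL _ (mem_nth (a, a) (ltn_ord i)).
- apply/trivIsetP => i j _ _; move/(pairwiseP (a, a)) : pL => pL ij.
  apply: nonoverlapping_disjoint.
  have [ltij|ltji|eqij] := ltngtP i j.
  + by apply: pL => //; exact: ltn_ord.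
  + by rewrite nonoverlappingC; apply: pL => //; exact: ltn_ord.
  + by move/val_inj : eqij ij => ->; rewrite eqxx.
- by move: Ld; rewrite /total_length (big_nth (a, a)) big_mkord.
Qed.

Fixpoint partition_cells a (s : seq R) : seq (R * R) :=
  if s is x :: s' then (a, x) :: partition_cells x s' else [::].

Lemma partition_cells_variation a b f s : itv_partition a b s ->
  variation a b f s = \sum_(I <- partition_cells a s) `|f I.2 - f I.1|.
Proof.
move=> abs; rewrite variation_zip//; elim: s a {abs} => [|x s IHs] a /=.
  by rewrite !big_nil.
by rewrite !big_cons IHs.
Qed.

Lemma partition_cells_family a s : path <%R a s ->
  interval_family a (last a s) (partition_cells a s).
Proof.
rewrite /interval_family; elim: s a => [|x s IHs] a //= /andP[ax xs].
have /andP[/allP all_s pw_s] := IHs x xs.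
have xl : x <= last x s by apply: (@itv_partition_le _ _ x (last x s) s); split.
rewrite lexx (ltW ax) xl pw_s /= andbT; apply/andP; split; apply/allP => I /all_s /and3P[].
  by move=> xI -> ->; rewrite (le_trans (ltW ax)).
by move=> xI _ _; rewrite /nonoverlapping /= xI.
Qed.

Lemma partition_cells_length a s : total_length (partition_cells a s) = last a s - a.
Proof.
rewrite /total_length; elim: s a => [|x s IHs] a /=; first by rewrite big_nil subrr.
by rewrite big_cons IHs /=; lra.
Qed.

(** Absolute continuity controls total variations, not only increments: replacing,
    one interval at a time, each interval by the cells of a partition leaves the total
    length unchanged, and the supremum over the partitions may be taken after each
    replacement.  The list L' collects the intervals already refined. *)
Lemma abs_continuous_total_variation a b f : abs_continuous_on a b f ->
  forall e, 0 < e -> exists2 d, 0 < d & forall L, interval_family a b L ->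
    total_length L < d -> (\sum_(I <- L) total_variation I.1 I.2 f <= e%:E)%E.
Proof.
move=> acf e e0; have [d d0 H] := abs_continuous_family acf e0; exists d => // L.
suff : forall L', interval_family a b (L' ++ L) -> total_length (L' ++ L) < d ->
    ((\sum_(I <- L') `|f I.2 - f I.1|)%:E + \sum_(I <- L) total_variation I.1 I.2 f
      <= e%:E)%E.
  by move=> /(_ [::]); rewrite /= big_nil add0e.
elim: L => [|[u v] L IHL] L' fL ltd.
  by rewrite big_nil adde0 lee_fin ltW//; move: (H L'); rewrite cats0 in fL ltd; apply.
move: (fL); rewrite /interval_family all_cat/= pairwise_cat/=.
move=> /andP[/and3P[allL' /and3P[au uv vb] allL]].
rewrite allrel_consr => /and3P[/andP[sepL' relL'L] pwL' /andP[sepL pwL]].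
have key s : itv_partition u v s ->
    ((\sum_(I <- L') `|f I.2 - f I.1| + variation u v f s)%:E +
     \sum_(I <- L) total_variation I.1 I.2 f <= e%:E)%E.
  move=> /[dup] uvs [us /eqP lasts].
  rewrite (partition_cells_variation _ uvs) [(\sum_(I <- L') _ + _)%R]addrC -big_cat/=.
  apply: IHL.
    have /andP[/allP all_s pw_s] := partition_cells_family us.
    have sub J I : J \in partition_cells u s -> nonoverlapping (u, v) I -> nonoverlapping J I.
      move=> /all_s /and3P[uJ JJ]; rewrite lasts /nonoverlapping/= => Jv /orP[vI|Iu].
        by rewrite (le_trans Jv vI).
      by rewrite (le_trans Iu uJ) orbT.
    rewrite /interval_family !all_cat allL allL' !andbT !pairwise_cat pw_s pwL pwL' !andbT /=.
    apply/and3P; split.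
    - apply/allP => I /all_s /and3P[uI -> Iv]; rewrite (le_trans au uI)/=.
      by rewrite (le_trans Iv)// lasts.
    - rewrite allrel_catl relL'L andbT; apply/allrelP => J I Js IL.
      by apply: sub => //; exact: (allP sepL).
    - apply/allrelP => J I Js IL'; apply: sub => //; rewrite nonoverlappingC.
      exact: (allP sepL').
  apply: le_lt_trans ltd; rewrite /total_length !big_cat/= big_cons/=.
  by have := partition_cells_length u s; rewrite /total_length lasts => ->; lra.
have S0 : (0 <= \sum_(I <- L) total_variation I.1 I.2 f)%E.
  rewrite big_seq_cond; apply: sume_ge0 => I; rewrite andbT => IL.
  by apply: total_variation_ge0; have /and3P[] := allP allL _ IL.
rewrite big_cons /=.
have Sfin : (\sum_(I <- L) total_variation I.1 I.2 f)%E \is a fin_num.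
  have [s0 uvs0] : exists s, itv_partition u v s.
    move: uv; rewrite le_eqVlt => /predU1P[->|uv].
      by exists [::]; split.
    by exists [:: v]; exact: itv_partition1.
  rewrite ge0_fin_numE//.
  by apply: le_lt_trans (ltry e); apply: le_trans (key _ uvs0); rewrite leeDr// lee_fin
    addr_ge0 ?variation_ge0// sumr_ge0.
rewrite addeA -leeBrDr// -leeBrDl//.
apply: ge_ereal_sup => _ [_ [s uvs <-] <-].
by rewrite leeBrDl// leeBrDr// -EFinD; exact: key.
Qed.

End nonoverlapping.

(** * Densities of absolutely continuous monotone functions *)

Section monotone_density.
Context {R : realType}.
Notation mu := (@lebesgue_measure R).
Implicit Types (a b d e x y : R) (L : seq (R * R)).

(** Absolute continuity on the whole line of a nondecreasing function. *)
Definition small_increments (W : R -> R) := forall e, 0 < e ->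
  exists2 d, 0 < d & forall L, all (fun I => I.1 <= I.2) L ->
    pairwise nonoverlapping L -> total_length L < d ->
    \sum_(I <- L) (W I.2 - W I.1) <= e.

Lemma small_increments_right_continuous (W : R -> R) :
  {homo W : x y / x <= y} -> small_increments W ->
  forall x, W @ at_right x --> W x.
Proof.
move=> ndW sW x; apply/cvgrPdist_le => e e0; have [d d0 H] := sW e e0.
near=> y.
have xy : x <= y by near: y; exact: nbhs_right_ge.
rewrite distrC ger0_norm ?subr_ge0 ?ndW//.
have := H [:: (x, y)]; rewrite /= big_seq1 /total_length big_seq1/=; apply => //.
  by rewrite xy.
by rewrite ltrBlDl; near: y; apply: nbhs_right_lt; rewrite ltrDl.
Unshelve. all: by end_near. Qed.

(** An empty component is encoded by the pair (b, b), placed to the right of all the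
    others so that the encoded intervals still do not overlap. *)
Lemma open_interval_endpoints (I : set R) a b : open I -> is_interval I ->
  I `<=` `]a, b[ ->
  exists uv : R * R, [/\ I = `]uv.1, uv.2[%classic, uv.1 <= uv.2, uv.2 <= b &
    uv.1 < uv.2 \/ uv.1 = b].
Proof.
move=> oI iI Iab; have [->|/set0P I0] := eqVneq I set0.
  by exists (b, b); rewrite /= set_itvoo0; split => //; right.
have hl : has_lbound I by exists a => x /Iab/=; rewrite in_itv/= => /andP[/ltW].
have hu : has_ubound I by exists b => x /Iab/=; rewrite in_itv/= => /andP[_ /ltW].
have IE : I = `]inf I, sup I[%classic.
  have := interval_bounded_interior iI hl hu.
  have /interior_id -> : open I by [].
  move=> E; rewrite [LHS]E; apply/seteqP; split => x /=; by rewrite in_itv.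
case: I0 => x Ix; have : I x by []; rewrite {1}IE /= in_itv/= => /andP[ix xs].
exists (inf I, sup I); split => //=; first by rewrite ltW// (lt_trans ix).
  apply: ge_sup; first by exists x.
  by move=> y /Iab/=; rewrite in_itv/= => /andP[_ /ltW].
by left; exact: lt_trans xs.
Qed.

(** Two nonempty open intervals that overlap share the midpoint of their
    intersection; the pair (b, b) stands for an empty interval. *)
Lemma disjoint_nonoverlapping (I J : R * R) b :
  I.2 <= b -> J.2 <= b -> I.1 < I.2 \/ I.1 = b -> J.1 < J.2 \/ J.1 = b ->
  `]I.1, I.2[%classic `&` `]J.1, J.2[ = set0 -> nonoverlapping I J.
Proof.
move=> Ib Jb [I12|I1b]; last by move=> _ _; rewrite /nonoverlapping I1b Jb orbT.
move=> [J12|J1b]; last by move=> _; rewrite /nonoverlapping J1b Ib.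
move=> IJ; rewrite /nonoverlapping; apply/negPn/negP.
rewrite negb_or -!ltNge => /andP[JI IJ'].
pose m := Num.max I.1 J.1; pose M := Num.min I.2 J.2.
have mM : m < M by rewrite /m /M gt_max !lt_min I12 IJ' JI J12.
have : (`]I.1, I.2[%classic `&` `]J.1, J.2[) ((m + M) / 2).
  have m1 : I.1 <= m by rewrite /m le_max lexx.
  have m2 : J.1 <= m by rewrite /m le_max lexx orbT.
  have M1 : M <= I.2 by rewrite /M ge_min lexx.
  have M2 : M <= J.2 by rewrite /M ge_min lexx orbT.
  by split; rewrite /= in_itv/=; apply/andP; split; lra.
by rewrite IJ.
Qed.

Lemma stieltjes_ocitv (W : cumulative R R) x y : x <= y ->
  lebesgue_stieltjes_measure W `]x, y] = (W y - W x)%:E.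
Proof.
move=> xy; rewrite /lebesgue_stieltjes_measure /measure_extension.
rewrite measurable_mu_extE/=; last exact: is_ocitv.
by rewrite wlength_itv_bnd.
Qed.

(** An open set is the disjoint union of countably many open intervals, so each
    partial sum of the Stieltjes measures of these intervals is at most a sum of
    increments over intervals of small total length. *)
Lemma small_increments_open (W : cumulative R R) e d (U : set R) a b :
  (forall L, all (fun I => I.1 <= I.2) L ->
    pairwise nonoverlapping L -> total_length L < d ->
    \sum_(I <- L) (W I.2 - W I.1) <= e) ->
  open U -> U `<=` `]a, b[ -> (mu U < d%:E)%E ->
  (lebesgue_stieltjes_measure W U <= e%:E)%E.
Proof.
move=> H oU Uab Ud; set nu := lebesgue_stieltjes_measure W.
have [I [/all_and2[oI iI] tI UI]] := OpenSetDisjointItvs.open_disjoint_itv oU.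
have Iab i : I i `<=` `]a, b[ by apply: subset_trans Uab; rewrite UI; exact: bigcup_sup.
have /choice[uv Huv] i := open_interval_endpoints (oI i) (iI i) (@Iab i).
have mI i : measurable (I i) by apply: open_measurable.
have mUI : measurable (\bigcup_i I i) by exact: bigcupT_measurable.
have part n (m : {measure set (measurableTypeR R) -> \bar R}) :
    (\sum_(0 <= i < n) m (I i) <= m U)%E.
  rewrite UI; have := @measure_semi_sigma_additive _ _ _ m I mI tI mUI.
  move=> /cvg_lim <-//.
  by apply: nneseries_lim_ge => i _ _; exact: measure_ge0.
have nuE : nu U = limn (fun n => \sum_(0 <= i < n) nu (I i))%E.
  rewrite UI; apply/esym/cvg_lim => //.
  exact: (@measure_semi_sigma_additive _ _ _ nu I mI tI mUI).
rewrite nuE; apply: lime_le.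
  by apply: is_cvg_nneseries => i _ _; exact: measure_ge0.
apply: nearW => n.
pose L := [seq uv i | i <- index_iota 0 n].
have uv_le i : (uv i).1 <= (uv i).2 by have [] := Huv i.
apply: (@le_trans _ _ (\sum_(J <- L) (W J.2 - W J.1))%:E).
  rewrite /L big_map -sumEFin; apply: lee_sum => i _.
  rewrite -stieltjes_ocitv//; have [-> _ _ _] := Huv i.
  by apply: le_measure; rewrite ?inE//; apply: subset_itvl; rewrite bnd_simp.
rewrite lee_fin; apply: H.
- by apply/allP => _ /mapP[i _ ->].
- rewrite /L pairwise_map.
  have : pairwise (fun i j : nat => i != j) (index_iota 0 n).
    by rewrite -uniq_pairwise iota_uniq.
  apply: sub_pairwise => i j ij /=.
  have [Ii _ ib ei] := Huv i; have [Ij _ jb ej] := Huv j.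
  apply: (disjoint_nonoverlapping ib jb ei ej).
  by rewrite -Ii -Ij; move/trivIsetP: tI; apply.
- rewrite -lte_fin; apply: le_lt_trans Ud; apply: le_trans (part n mu).
  rewrite /total_length /L big_map -sumEFin; apply: lee_sum => i _.
  have [IE _ _ _] := Huv i.
  have := @lebesgue_measure_itv R `](uv i).1, (uv i).2[; rewrite /= -IE lte_fin => muI.
  apply: (@le_trans _ _ (lebesgue_measure (I i))) => //; rewrite muI.
  by case: ltP (uv_le i) => [|? ?] //; rewrite lee_fin subr_le0.
Qed.

(** Small increments make the Stieltjes measure of W absolutely continuous
    with respect to Lebesgue measure: a null set is covered by an open set of small
    Lebesgue measure.  The density is given by Radon-Nikodym. *)
Lemma monotone_density (W : R -> R) a b : a <= b ->
  {homo W : x y / x <= y} -> small_increments W ->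
  exists2 rho : R -> R, mu.-integrable setT (EFin \o rho) &
    forall x y, a <= x -> x <= y -> y <= b ->
      (W y - W x)%:E = (\int[mu]_(t in `]x, y]) (rho t)%:E)%E.
Proof.
move=> ab ndW sW.
pose cW := isCumulative.Build R _ R W ndW (small_increments_right_continuous ndW sW).
pose V : cumulative R R := HB.pack W cW.
pose nu := lebesgue_stieltjes_measure V.
have mab : measurable (`]a, b]%classic : set (measurableTypeR R)) by [].
have nuab : (nu `]a, b]%classic < +oo)%E by rewrite /nu stieltjes_ocitv// ltry.
pose nu' : {finite_measure set (measurableTypeR R) -> \bar R} := mfrestr mab nuab.
have dom : nu' `<< mu.
  apply/null_content_dominatesP => A mA A0.
  apply/eqP; rewrite eq_le measure_ge0 andbT; apply/lee_addgt0Pr => e e0.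
  rewrite add0e; have [d d0 H] := sW e e0.
  have d20 : 0 < d / 2 by rewrite divr_gt0.
  have [U [oU AU Ud]] := outer_measure_open_le A d20.
  (* Cutting U to a bounded interval provides the bounds needed to encode empty
     components. *)
  pose U' := U `&` `]a - 1, b + 1[%classic.
  apply: (@le_trans _ _ (nu U')).
    rewrite /nu' /mfrestr /mrestr /=; apply: le_measure; rewrite ?inE//.
    - exact: measurableI.
    - by apply: open_measurable; apply: openI => //; exact: interval_open.
    - move=> x [/AU Ux]; rewrite /= in_itv/= => /andP[ax xb]; split => //=.
      by rewrite in_itv/=; apply/andP; split; lra.
  apply: (@small_increments_open V e d U' (a - 1) (b + 1) H).
  - by apply: openI => //; exact: interval_open.
  - exact: subIsetr.
  - apply: (@le_lt_trans _ _ (mu U)).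
      by apply: le_outer_measure; exact: subIsetl.
    apply: (le_lt_trans Ud).
    have -> : ((wlength idfun)^* A)%mu = 0%E by exact: A0.
    by rewrite add0e lte_fin ltr_pdivrMr// ltr_pMr// ltr1n.
have [f [f0 ffin fint fE]] := radon_nikodym_sigma_finite dom.
exists (fine \o f).
  by apply: eq_integrable fint => // x _ /=; rewrite fineK.
move=> x y ax xy yb.
transitivity (nu' `]x, y]%classic).
  have -> : nu' `]x, y]%classic = nu (`]x, y]%classic `&` `]a, b]%classic) by [].
  suff -> : `]x, y]%classic `&` `]a, b]%classic = `]x, y]%classic :> set R.
    by rewrite /nu stieltjes_ocitv.
  apply/seteqP; split => z /=; rewrite !in_itv/=; first by case.
  move=> /andP[xz zy]; split; first exact/andP.
  by rewrite (le_lt_trans ax xz) (le_trans zy yb).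
rewrite fE//; apply: eq_integral => t _.
by rewrite /= fineK.
Qed.

End monotone_density.

(** * Increments of absolutely continuous functions *)

Section absolutely_continuous.
Context {R : realType}.
Notation mu := (@lebesgue_measure R).
Implicit Types (a b d e x y : R) (L : seq (R * R)) (G : R -> R).

(** Cut [a, x] by points of step d/2, where d bounds the lengths of the families
    whose variation is at most 1; each of the finitely many cells has variation at most 1. *)
Lemma abs_continuous_bounded_variation a b G x : abs_continuous_on a b G ->
  a <= x -> x <= b -> total_variation a x G \is a fin_num.
Proof.
move=> acG ax xb; have ab := le_trans ax xb.
rewrite ge0_fin_numE; last exact: total_variation_ge0.
have [d d0 H] := abs_continuous_total_variation acG (ltr01 : 0 < 1 :> R).
pose z n := Num.min x (a + n%:R * (d / 2)).
have d20 : 0 < d / 2 by rewrite divr_gt0.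
have az n : a <= z n by rewrite /z le_min ax lerDl mulr_ge0// ltW.
have zx n : z n <= x by rewrite /z ge_min lexx.
have zS n : z n <= z n.+1.
  by rewrite /z le_min2// lerD2l ler_wpM2r ?(ltW d20)// ler_nat.
have zd n : z n.+1 - z n < d.
  have dd : d / 2 < d by rewrite ltr_pdivrMr// ltr_pMr// ltr1n.
  rewrite /z; case: (leP x (a + n%:R * (d / 2))) => H1.
    by rewrite (@le_lt_trans _ _ 0)// subr_le0 zx.
  rewrite (@le_lt_trans _ _ (d / 2))// lerBlDr ge_min -[n.+1%:R]natr1; apply/orP; right; lra.
have zfin n : (total_variation a (z n) G < +oo)%E.
  elim: n => [|n IHn].
    rewrite (_ : z 0 = a) ?total_variationxx ?ltry//.
    by rewrite /z mul0r addr0; exact/min_idPr.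
  rewrite (total_variationD _ (az n) (zS n)) lte_add_pinfty//.
  have := H [:: (z n, z n.+1)]; rewrite big_seq1 /total_length big_seq1/= => /(_ _ (zd n)).
  move=> H1; apply: le_lt_trans (H1 _) (ltry 1).
  by rewrite /interval_family/= az zS (le_trans (zx _) xb).
have [n xn] : exists n, x <= a + n%:R * (d / 2).
  exists (Num.truncn ((x - a) / (d / 2))).+1.
  rewrite -lerBlDl -ler_pdivrMr// ltW//; exact: Num.Theory.truncnS_gt.
have := zfin n; rewrite (_ : z n = x)//; exact/min_idPl.
Qed.

(** The projection of the line onto [a, b]; composing with it extends a function on
    [a, b] to the line by constants. *)
Definition clamp a b x := Num.max a (Num.min b x).

Lemma clamp_id a b x : a <= x -> x <= b -> clamp a b x = x.
Proof. by move=> ax xb; rewrite /clamp (min_idPr xb); exact/max_idPr. Qed.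

Lemma clamp_ge a b x : a <= clamp a b x.
Proof. by rewrite /clamp le_max lexx. Qed.

Lemma clamp_le a b x : a <= b -> clamp a b x <= b.
Proof. by move=> ab; rewrite /clamp ge_max ab ge_min lexx. Qed.

Lemma clamp_homo a b x y : x <= y -> clamp a b x <= clamp a b y.
Proof. by move=> xy; rewrite /clamp le_max2// le_min2. Qed.

Lemma clamp_dist a b x y : a <= b -> x <= y -> clamp a b y - clamp a b x <= y - x.
Proof.
move=> ab xy; rewrite /clamp !maxEle !minEle.
by case: (leP b y) => ?; case: (leP b x) => ?;
  case: (leP a b) => ?; case: (leP a y) => ?; case: (leP a x) => ?; lra.
Qed.

(** With V the variation of G from a, both V and V + G are nondecreasing with small
    increments, and G is their difference. *)
Lemma abs_continuous_density a b G : a <= b -> abs_continuous_on a b G ->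
  exists2 rho : R -> R, mu.-integrable setT (EFin \o rho) &
    forall x y, a <= x -> x <= y -> y <= b ->
      (G y - G x)%:E = (\int[mu]_(t in `]x, y]) (rho t)%:E)%E.
Proof.
move=> ab acG.
pose c := clamp a b.
have ca x : a <= c x by exact: clamp_ge.
have cb x : c x <= b by exact: clamp_le.
have cm x y : x <= y -> c x <= c y by exact: clamp_homo.
pose V x := fine (total_variation a (c x) G).
have fin x : total_variation a (c x) G \is a fin_num.
  exact: (abs_continuous_bounded_variation acG).
have VB x y : x <= y -> (V y - V x)%:E = total_variation (c x) (c y) G.
  move=> xy; have E := total_variationD G (ca x) (cm _ _ xy).
  have fin2 : total_variation (c x) (c y) G \is a fin_num.
    by move: (fin y); rewrite E fin_numD => /andP[].
  by rewrite /V E fineD// addrAC subrr add0r fineK.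
have GV x y : x <= y -> `|G (c y) - G (c x)| <= V y - V x.
  by move=> xy; rewrite -lee_fin VB//; apply: total_variation_ge; exact: cm.
have ndV : {homo V : x y / x <= y}.
  by move=> x y xy; rewrite -subr_ge0 (le_trans _ (GV _ _ xy)).
have sV : small_increments V.
  move=> e e0; have [d d0 H] := abs_continuous_total_variation acG e0.
  exists d => // L aL pL Ld.
  have := H (map (fun I : R * R => (c I.1, c I.2)) L).
  rewrite !big_map /= -lee_fin -sumEFin => H'.
  rewrite (eq_big_seq (fun I : R * R => total_variation (c I.1) (c I.2) G)); last first.
    by move=> I IL; rewrite VB//; exact: (allP aL).
  apply: H'.
    rewrite /interval_family; apply/andP; split.
      by apply/allP => _ /mapP[I IL ->] /=; rewrite ca cb cm// (allP aL).
    rewrite pairwise_map; apply: sub_pairwise pL => I J.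
    by rewrite /nonoverlapping/= => /orP[] /cm ->; rewrite ?orbT.
  apply: le_lt_trans Ld; rewrite /total_length big_map big_seq [leRHS]big_seq.
  by apply: ler_sum => I IL; apply: clamp_dist => //; exact: (allP aL).
pose W x := V x + G (c x).
have ndW : {homo W : x y / x <= y}.
  move=> x y xy; have := GV _ _ xy; rewrite ler_norml /W => /andP[] *; lra.
have sW : small_increments W.
  move=> e e0; have [d d0 H] := sV (e / 2) (divr_gt0 e0 (ltr0n _ 2)).
  exists d => // L aL pL Ld.
  apply: (@le_trans _ _ (2 * \sum_(I <- L) (V I.2 - V I.1))); last first.
    by have := H L aL pL Ld; lra.
  rewrite mulr_sumr big_seq [leRHS]big_seq; apply: ler_sum => I IL.
  have := GV _ _ (allP aL _ IL); rewrite ler_norml /W => /andP[] *; lra.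
have [r1 ir1 Hr1] := monotone_density ab ndV sV.
have [r2 ir2 Hr2] := monotone_density ab ndW sW.
exists (r2 \- r1); first by have := integrableB measurableT ir2 ir1.
move=> x y ax xy yb.
transitivity ((W y - W x)%:E - (V y - V x)%:E)%E.
  rewrite -EFinB /W /c (clamp_id ax (le_trans xy yb)) (clamp_id (le_trans ax xy) yb).
  by congr EFin; ring.
rewrite Hr1// Hr2// -integralB_EFin//.
- exact: integrableS ir2.
- exact: integrableS ir1.
Qed.

(** The Lebesgue differentiation theorem identifies the density. *)
Lemma abs_continuous_derive1_density a b G (rho : R -> R) :
  mu.-integrable setT (EFin \o rho) ->
  (forall x y, a <= x -> x <= y -> y <= b ->
      (G y - G x)%:E = (\int[mu]_(t in `]x, y]) (rho t)%:E)%E) ->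
  {ae mu, forall x, a < x < b -> G^`()%classic x = rho x}.
Proof.
move=> irho HG.
have lrho : locally_integrable setT rho.
  by apply: open_integrable_locally => //; exact: openT.
have : forall y, mu.-integrable [set` Interval (BRight a) (BRight y)] (EFin \o rho).
  by move=> y; apply: integrableS irho.
move=> /(@FTC1 R rho (BRight a)) /(_ lrho) /=.
apply: filterS; first exact: (ae_filter_ringOfSetsType mu).
move=> x H /andP[ax xb]; have [|dF <-] := H; first by rewrite lte_fin.
set F := fun y => _ in dF *.
rewrite !derive1E.
rewrite (@near_eq_derive _ _ _ _ (F + cst (G a))).
- have dF1 : is_derive x 1 F ('D_1 F x) by exact: derivableP.
  have dc : is_derive x 1 (cst (G a)) (0 : R) by exact: is_derive_cst.
  have := @is_deriveD _ _ _ _ _ _ _ _ _ dF1 dc.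
  by move=> /@derive_val ->; rewrite addr0.
near=> y.
have ay : a <= y by apply: ltW; near: y; exact: lt_nbhsr.
have yb : y <= b by apply: ltW; near: y; exact: lt_nbhsl.
have -> : (F + cst (G a)) y = F y + G a by [].
by rewrite /F /Rintegral -HG//= subrK.
Unshelve. all: by end_near. Qed.

(** The inequality form of the fundamental theorem of calculus for absolutely
    continuous functions.  It is stated for a Borel representative of the
    derivative. *)
Lemma abs_continuous_increment_le G (g0 : R -> R) x y :
  (forall a b, abs_continuous_on a b G) ->
  measurable_fun setT g0 -> null_eq G^`()%classic g0 -> x <= y ->
  (`|G y - G x|%:E <= \int[mu]_(t in `[x, y]) `|g0 t|%:E)%E.
Proof.
move=> acG mg0 Gg0 xy.
have [rho irho HG] := abs_continuous_density xy (acG x y).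
have Grho := abs_continuous_derive1_density irho HG.
have mrho : measurable_fun setT rho.
  by move/integrableP : irho => [/measurable_EFinP].
have mn (h : R -> R) : measurable_fun setT h -> measurable_fun setT (fun t => `|h t|%:E).
  by move=> mh; apply/measurable_EFinP; exact: measurableT_comp.
rewrite -abse_EFin (HG x y)//.
apply: (@le_trans _ _ (\int[mu]_(t in `]x, y]) `|(rho t)%:E|)%E).
  apply: le_abse_integral => //; apply: measurable_funTS; exact/measurable_EFinP.
rewrite integral_itv_bndoo; last by apply: measurable_funTS; exact: mn.
rewrite [leRHS]integral_itv_bndoo; last by apply: measurable_funTS; exact: mn.
rewrite le_eqVlt; apply/orP; left; apply/eqP.
apply: ge0_ae_eq_integral => //.
- by apply: measurable_funTS; exact: mn.
- by apply: measurable_funTS; exact: mn.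
apply: negligibleS (negligibleU Grho Gg0) => t /= /not_implyP[].
rewrite in_itv/= => txy tN.
have [E|] := pselect (G^`()%classic t = g0 t); last by right.
left; apply/not_implyP; split => // E'; apply: tN.
by rewrite /= -E' E.
Qed.

End absolutely_continuous.

(** * Finite differences *)

Section difference_theory.
Context {R : realType}.
Implicit Types (f g u : R -> R) (h x y : R).

Lemma difference0 h f x : difference 0 h f x = f x.
Proof. by rewrite /difference big_nat1 bin0 expr0 !mul1r subn0 mul0r addr0. Qed.

Lemma differenceS s h f x :
  difference s.+1 h f x = difference s h f (x + h) - difference s h f x.
Proof.
rewrite {1}/difference big_nat_recl//= bin0 expr0 !mul1r subn0.
under eq_bigr => nu _ do rewrite subSS binS natrD 2!mulrDl.
rewrite big_split/= addrA; congr (_ + _); last first.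
  by rewrite /difference -sumrN; apply: eq_bigr => nu _; rewrite exprS; ring.
rewrite big_nat_recr//= bin_small// !mul0r addr0.
rewrite /difference big_nat_recl//= bin0 expr0 !mul1r subn0.
congr (f _ + _); first by rewrite -natr1; ring.
rewrite !big_nat; apply: eq_bigr => nu /andP[_ nus].
congr (_ * f _); rewrite -(subnSK nus) -natr1; ring.
Qed.

Lemma difference_shift s h f c x :
  difference s h (fun y => f (y + c)) x = difference s h f (x + c).
Proof. by apply: eq_bigr => nu _; rewrite addrAC. Qed.

Lemma differenceD s h f g x :
  difference s h (f \+ g) x = difference s h f x + difference s h g x.
Proof. by rewrite -big_split; apply: eq_bigr => nu _; rewrite mulrDr. Qed.

Lemma differenceB s h f g x :
  difference s h (f \- g) x = difference s h f x - difference s h g x.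
Proof. by rewrite /difference -sumrB; apply: eq_bigr => nu _; rewrite mulrBr. Qed.

(** A difference of order s + 1 of f is a difference of order s of a first
    difference; this passes one derivative to the first difference, which is where
    absolute continuity is used. *)
Lemma differenceSr s h f x :
  difference s.+1 h f x = difference s h (fun y => f (y + h) - f y) x.
Proof.
rewrite differenceS -difference_shift -differenceB.
by congr difference.
Qed.

Lemma difference_add m s h f x :
  difference (m + s) h f x = difference m h (difference s h f) x.
Proof.
elim: m x => [|m IHm] x; first by rewrite difference0.
by rewrite addSn !differenceS !IHm.
Qed.

Lemma difference_le m h f x M :
  (forall j, (j <= m)%N -> `|f (x + j%:R * h)| <= M) ->
  `|difference m h f x| <= 2 ^+ m * M.
Proof.
elim: m x => [|m IHm] x fM.
  by rewrite difference0 expr0 mul1r; have := fM 0%N (leqnn _); rewrite mul0r addr0.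
rewrite differenceS exprS -mulrA mulr_natl mulr2n (le_trans (ler_normB _ _))//.
apply: lerD; apply: IHm => j jm.
  by have := fM j.+1 jm; rewrite -natr1; congr (`|f _| <= _); ring.
exact: (fM j (leqW jm)).
Qed.

Lemma is_derive1_shift u (x h a : R) :
  is_derive (x + h) 1 u a -> is_derive x 1 (fun y => u (y + h)) a.
Proof.
move=> Du; have Ds : is_derive x 1 (shift h) (1 : R) by exact: is_derive_shift.
have Du' : is_derive (shift h x) 1 u a := Du.
by have := is_derive1_comp Du' Ds; rewrite mulr1.
Qed.

Lemma is_derive_difference k h (u u' : R -> R) :
  (forall x, is_derive x (1:R) u (u' x)) ->
  forall x, is_derive x (1:R) (difference k h u) (difference k h u' x).
Proof.
move=> Du; elim: k => [|k IHk] x.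
  by rewrite difference0 (_ : difference 0 h u = u)//; apply/funext => y; rewrite difference0.
rewrite (_ : difference k.+1 h u =
    (fun y => difference k h u (y + h)) - difference k h u); last first.
  by apply/funext => y; rewrite differenceS.
rewrite differenceS; apply: is_deriveB.
by apply: is_derive1_shift.
Qed.

(** Iterated mean value theorem.  The set P makes the bound local, and the step may
    be negative because symmetric differences use both signs. *)
Lemma difference_mean_value k h u (P : set R) M y : is_interval P ->
  (forall i, (i < k)%N -> forall x, derivable u^`(i)%classic x 1) ->
  (forall z, P z -> `|u^`(k)%classic z| <= M) ->
  P y -> P (y + k%:R * h) -> `|difference k h u y| <= `|h| ^+ k * M.
Proof.
move=> iP; elim: k u y => [|k IHk] u y du uM Py Pyk.
  by rewrite difference0 expr0 mul1r; exact: uM.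
have Du x : is_derive x (1:R) u (u^`()%classic x).
  by rewrite derive1E; apply: derivableP; exact: (du 0%N).
have IH z : P z -> P (z + k%:R * h) -> `|difference k h u^`()%classic z| <= `|h| ^+ k * M.
  apply: IHk => // [i ik x|x]; rewrite -derive1Sn; [exact: du|exact: uM].
have Dd := @is_derive_difference k h u _ Du.
have cd a b : {within `[a, b], continuous (difference k h u)}.
  by apply: derivable_within_continuous => x _; exact: ex_derive.
have Pseg x : Num.min y (y + h) <= x <= Num.max y (y + h) -> P x /\ P (x + k%:R * h).
  have k0 : 0 <= k%:R :> R by [].
  rewrite -natr1 mulrDl mul1r addrA in Pyk.
  rewrite ge_min le_max => Hx.
  have [h0|h0] := leP 0 h.
    have kh : 0 <= k%:R * h by exact: mulr_ge0.
    have [yx xyh] : y <= x /\ x <= y + h.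
      case/andP: Hx => /orP H1 /orP H2; split.
        by case: H1 => //; lra.
      by case: H2 => //; lra.
    by split; apply: iP Py Pyk _ _; apply/andP; split; lra.
  have kh : k%:R * h <= 0 by exact: mulr_ge0_le0 (ltW h0).
  have [yx xyh] : y + h <= x /\ x <= y.
    case/andP: Hx => /orP H1 /orP H2; split.
      by case: H1 => //; lra.
    by case: H2 => //; lra.
  by split; apply: iP Pyk Py _ _; apply/andP; split; lra.
rewrite differenceS exprS -mulrA.
suff [x Hx ->] : exists2 x, Num.min y (y + h) <= x <= Num.max y (y + h) &
    `|difference k h u (y + h) - difference k h u y| =
    `|h| * `|difference k h u^`()%classic x|.
  by rewrite ler_wpM2l//; have [] := Pseg x Hx; exact: IH.
have [h0|h0] := leP 0 h.
  have [|c cI E] := @MVT_segment R (difference k h u) _ y (y + h) _ (fun x _ => Dd x) (cd _ _).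
    by rewrite lerDl.
  exists c; first by move: cI; rewrite in_itv/= min_l ?max_r// lerDl.
  by rewrite E addrAC subrr add0r normrM mulrC.
have [|c cI E] := @MVT_segment R (difference k h u) _ (y + h) y _ (fun x _ => Dd x) (cd _ _).
  by rewrite gerDl ltW.
exists c; first by move: cI; rewrite in_itv/= min_r ?max_l// gerDl ltW.
rewrite distrC E normrM mulrC; congr (_ * _); rewrite -normrN; congr `|_|; ring.
Qed.

End difference_theory.

(** * Locally integrable functions *)

Section loc_integrable_theory.
Context {R : realType}.
Notation mu := (@lebesgue_measure R).
Implicit Types (f g u : R -> R) (a b c k x y : R).

Let mitv a b : measurable (`[a, b]%classic : set (measurableTypeR R)).
Proof. exact: measurable_itv. Qed.

Lemma continuous_loc_integrable f : continuous f -> loc_integrable f.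
Proof.
move=> cf; split; first exact: continuous_measurable_fun.
move=> a b; apply: continuous_compact_integrable; first exact: segment_compact.
exact: continuous_subspaceT.
Qed.

Lemma loc_integrable_abs f : loc_integrable f -> loc_integrable (fun x => `|f x|).
Proof.
by move=> [mf lf]; split; [exact: measurableT_comp|move=> a b; exact: integrable_norm (lf a b)].
Qed.

Lemma loc_integrableZ f c : loc_integrable f -> loc_integrable (fun x => c * f x).
Proof.
move=> [mf lf]; split; first exact: measurable_funM.
by move=> a b; have := integrableZl (mitv a b) c (lf a b).
Qed.

Lemma loc_integrableD f g : loc_integrable f -> loc_integrable g ->
  loc_integrable (fun x => f x + g x).
Proof.
move=> [mf lf] [mg lg]; split; first exact: measurable_funD.
by move=> a b; have := integrableD (mitv a b) (lf a b) (lg a b).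
Qed.

Lemma loc_integrableB f g : loc_integrable f -> loc_integrable g ->
  loc_integrable (fun x => f x - g x).
Proof.
move=> [mf lf] [mg lg]; split; first exact: measurable_funB.
by move=> a b; have := integrableB (mitv a b) (lf a b) (lg a b).
Qed.

Lemma loc_integrable_cst c : loc_integrable (fun=> c).
Proof. by apply: continuous_loc_integrable; exact: cst_continuous. Qed.

Lemma loc_integrable_sum (I : Type) (r : seq I) (F : I -> R -> R) :
  (forall i, loc_integrable (F i)) -> loc_integrable (fun x => \sum_(i <- r) F i x).
Proof.
move=> lF; elim: r => [|i r IHr].
  by under eq_fun do rewrite big_nil; exact: loc_integrable_cst.
by under eq_fun do rewrite big_cons; exact: loc_integrableD.
Qed.

Lemma loc_integrable_affine f c k : k != 0 -> loc_integrable f ->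
  loc_integrable (fun t => f (c + k * t)).
Proof.
move=> k0 [mf lf]; split; first exact: (measurableT_comp mf (measurable_affine c k)).
move=> a b; apply/integrableP; split.
  apply: measurable_funTS; apply/measurable_EFinP.
  exact: (measurableT_comp mf (measurable_affine c k)).
pose al := Num.min (c + k * a) (c + k * b); pose be := Num.max (c + k * a) (c + k * b).
have kp : 0 < `|k| by rewrite normr_gt0.
have mabs : measurable_fun setT (fun t => `|f t|%:E).
  by apply/measurable_EFinP; exact: measurableT_comp.
have /integrableP[_] := lf al be.
rewrite (ge0_integral_affine c k0)// -lte_pdivlMl//.
move=> /(fun H => lt_le_trans H (leey _)); apply: le_lt_trans.
apply: ge0_subset_integral => //.
- by rewrite -[X in measurable X]setTI; exact: measurable_affine.
- apply: measurable_funTS; apply: (measurableT_comp mabs (measurable_affine c k)).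
move=> t; rewrite /= !in_itv/= /al /be ge_min le_max => /andP[at_ tb].
have [k_gt0|k_le0] := leP 0 k.
  by apply/andP; split; apply/orP; [left|right]; rewrite lerD2l ler_wpM2l.
by apply/andP; split; apply/orP; [right|left]; rewrite lerD2l ler_wnM2l// ltW.
Qed.

Lemma loc_integrable_shift f c : loc_integrable f -> loc_integrable (fun t => f (c + t)).
Proof.
move=> /(loc_integrable_affine c (oner_neq0 R)).
by under eq_fun do rewrite mul1r.
Qed.

Lemma Rintegral_sum (I : Type) (r : seq I) (c : I -> R) (F : I -> R -> R) a b :
  (forall i, loc_integrable (F i)) ->
  \int[mu]_(t in `[a, b]) (\sum_(i <- r) c i * F i t) =
  \sum_(i <- r) c i * \int[mu]_(t in `[a, b]) F i t.
Proof.
move=> lF; elim: r => [|i r IHr].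
  under eq_Rintegral do rewrite big_nil.
  by rewrite big_nil Rintegral_cst// mul0r.
under eq_Rintegral do rewrite big_cons.
rewrite big_cons RintegralD//.
- by rewrite IHr RintegralZl//; have [_] := lF i.
- by have [_] := loc_integrableZ (c i) (lF i); exact.
- have [_] := @loc_integrable_sum _ r (fun i x => c i * F i x)
    (fun i => loc_integrableZ (c i) (lF i)); exact.
Qed.

Lemma Rintegral_affine_itv f c k a b : 0 < k -> loc_integrable f ->
  \int[mu]_(t in `[a, b]) f (c + k * t) =
  k^-1 * \int[mu]_(t in `[c + k * a, c + k * b]) f t.
Proof.
move=> k0 [mf lf]; have kN0 : k != 0 by rewrite gt_eqF.
rewrite [X in _ = _ * X](Rintegral_affine c kN0)// preimage_affine_itv//.
by rewrite gtr0_norm// mulKf.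
Qed.

Lemma Rintegral_opp_itv f d : loc_integrable f ->
  \int[mu]_(t in `[- d, d]) f (- t) = \int[mu]_(t in `[- d, d]) f t.
Proof.
move=> [mf lf]; have N1 : (-1 : R) != 0 by rewrite oppr_eq0 oner_neq0.
rewrite [RHS](Rintegral_affine 0 N1)// normrN normr1 mul1r.
rewrite (_ : _ @^-1` _ = `[- d, d]%classic).
  by apply: eq_Rintegral => t _; rewrite add0r mulN1r.
by apply/seteqP; split => t /=; rewrite !in_itv/= add0r mulN1r lerN2 lerNl => /andP[-> ->].
Qed.

Lemma le_Rintegral_abs_sub f a b c d : loc_integrable f -> c <= a -> b <= d ->
  \int[mu]_(t in `[a, b]) `|f t| <= \int[mu]_(t in `[c, d]) `|f t|.
Proof.
move=> lf ca bd; have [mf' lf'] := loc_integrable_abs lf.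
rewrite /Rintegral fine_le//; try exact: integrable_fin_num.
apply: ge0_subset_integral => //.
  by apply: measurable_funTS; exact/measurable_EFinP.
by apply: subset_itv; rewrite bnd_simp.
Qed.

Lemma Rintegral_abs_fineK f a b : loc_integrable f ->
  ((\int[mu]_(t in `[a, b]) `|f t|)%:E = \int[mu]_(t in `[a, b]) `|f t|%:E)%E.
Proof.
move=> /loc_integrable_abs[mf lf].
by rewrite /Rintegral fineK//; exact: integrable_fin_num.
Qed.

End loc_integrable_theory.

(** * Finite differences of Sobolev functions *)

Section sobolev_differences.
Context {R : realType}.
Notation mu := (@lebesgue_measure R).
Implicit Types (f g u : R -> R) (a b c k x y : R).

Lemma abs_continuous_continuous g : (forall a b, abs_continuous_on a b g) -> continuous g.
Proof.
move=> acg x; apply/cvgrPdist_lt => e e0.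
have [d d0 H] := abs_continuous_family (acg (x - 1) (x + 1)) e0.
near=> y.
have yd : `|x - y| < d by near: y; apply: cvgr_dist_lt => //; exact: cvg_id.
have y1 : `|x - y| < 1 by near: y; apply: cvgr_dist_lt => //; exact: cvg_id.
move: yd; rewrite ltr_norml => /andP[? ?].
move: y1; rewrite ltr_norml => /andP[? ?].
have [xy|yx] := leP x y.
  have := H [:: (x, y)]; rewrite big_seq1 /total_length big_seq1 /= distrC; apply; last lra.
  by rewrite /interval_family/= xy/=; apply/andP; split => //; lra.
have := H [:: (y, x)]; rewrite big_seq1 /total_length big_seq1 /=; apply; last lra.
by rewrite /interval_family/= (ltW yx)/= !andbT; apply/andP; split; lra.
Unshelve. all: by end_near. Qed.

Lemma derivable_all_continuous g : (forall x, derivable g x 1) -> continuous g.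
Proof.
move=> dg x; apply: differentiable_continuous.
by apply/derivable1_diffP.
Qed.

Lemma derive1n_increment (k : nat) g h :
  (forall i, (i < k)%N -> forall x, derivable g^`(i)%classic x 1) ->
  forall i, (i <= k)%N ->
  (fun y => g (y + h) - g y)^`(i)%classic = fun z => g^`(i)%classic (z + h) - g^`(i)%classic z.
Proof.
move=> dg; elim=> [//|i IHi] ik; rewrite derive1nS IHi; last exact: ltnW.
apply/funext => z; rewrite derive1E.
have D x : is_derive x (1:R) g^`(i)%classic (g^`(i.+1)%classic x).
  by rewrite derive1nS derive1E; apply: derivableP; exact: dg.
have := is_deriveB (is_derive1_shift (D (z + h))) (D z).
by move=> /@derive_val.
Qed.

(** Only k derivatives are available at every point, so k of the k + 1 differences are
    removed by the mean value theorem and the last one is bounded by the integral of the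
    (k + 1)-st derivative. *)
Lemma difference_le_integral (k : nat) g g0 h y a b :
  (forall i, (i < k)%N -> forall x, derivable g^`(i)%classic x 1) ->
  (forall a b, abs_continuous_on a b g^`(k)%classic) ->
  loc_integrable g0 -> null_eq g^`(k.+1)%classic g0 ->
  a <= y -> y <= b -> a <= y + k.+1%:R * h -> y + k.+1%:R * h <= b ->
  `|difference k.+1 h g y| <= `|h| ^+ k * \int[mu]_(t in `[a, b]) `|g0 t|.
Proof.
move=> dg acg lg0 gg0 ay yb ay' yb'.
have [mg0 _] := lg0.
have incr x x' : a <= x <= b -> a <= x' <= b ->
    `|g^`(k)%classic x' - g^`(k)%classic x| <= \int[mu]_(t in `[a, b]) `|g0 t|.
  wlog xx' : x x' / x <= x'.
    move=> H; have [xx'|/ltW x'x] := leP x x'; first exact: H.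
    by move=> Hx Hx'; rewrite distrC; exact: H.
  move=> /andP[ax xb] /andP[ax' xb'].
  apply: le_trans (le_Rintegral_abs_sub lg0 ax xb').
  rewrite -lee_fin Rintegral_abs_fineK//.
  exact: abs_continuous_increment_le.
rewrite differenceSr.
(* The points at which the first difference of step h stays inside [a, b]. *)
pose P := [set z | a <= z <= b /\ a <= z + h <= b].
have incD := derive1n_increment h dg.
have k0 : 0 <= k%:R :> R by [].
have kE : k.+1%:R * h = k%:R * h + h by rewrite -natr1 mulrDl mul1r.
rewrite kE in ay' yb'.
apply: (@difference_mean_value _ _ _ _ P).
- move=> x z [/andP[? ?] /andP[? ?]] [/andP[? ?] /andP[? ?]] t /andP[? ?].
  by split; apply/andP; split; lra.
- move=> i ik x; rewrite incD; last exact: ltnW.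
  have D z : is_derive z (1:R) g^`(i)%classic (g^`(i.+1)%classic z).
    by rewrite derive1nS derive1E; apply: derivableP; exact: dg.
  have := is_deriveB (is_derive1_shift (D (x + h))) (D x).
  by move=> [].
- by move=> z [Pz Pzh]; rewrite incD//; exact: incr.
- split; first by rewrite ay.
  have [h0|h0] := leP 0 h.
    have kh : 0 <= k%:R * h by exact: mulr_ge0.
    by apply/andP; split; lra.
  have kh : k%:R * h <= 0 by exact: mulr_ge0_le0 (ltW h0).
  by apply/andP; split; lra.
- have [h0|h0] := leP 0 h.
    have kh : 0 <= k%:R * h by exact: mulr_ge0.
    by split; apply/andP; split; lra.
  have kh : k%:R * h <= 0 by exact: mulr_ge0_le0 (ltW h0).
  by split; apply/andP; split; lra.
Qed.

End sobolev_differences.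

(** * Generalized Steklov averages *)

Section steklov_theory.
Context {R : realType}.
Notation mu := (@lebesgue_measure R).
Implicit Types (f g u : R -> R) (a b c k x y d : R).

Definition steklov_coef (r : nat) : R := (-1) ^+ r.+1 * 'C(2 * r, r)%:R^-1.

Lemma steklov_coef_norm r : `|steklov_coef r| <= 1.
Proof.
rewrite /steklov_coef normrM normrX normrN1 expr1n mul1r.
rewrite normfV normr_nat invf_le1 ?ltr0n ?bin_gt0 ?ler1n ?bin_gt0 ?leq_pmull//.
Qed.

(** Replacing f by a locally integrable representative does not change the value at
    any point, since the integrand changes only on a null set. *)
Lemma steklovE d r f f0 x : (0 < r)%N -> loc_integrable f0 -> null_eq f f0 ->
  steklov d r f x = steklov_coef r * (2 / d) *
   \sum_(0 <= nu < r) ((-1) ^+ nu * 'C(2 * r, nu)%:R) *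
     \int[mu]_(t in `[- (d / 2), d / 2]) f0 (x + (r - nu)%:R / r%:R * t).
Proof.
move=> r0 lf0 ff0; rewrite /steklov; congr (_ * _).
have kN0 nu : (nu < r)%N -> (r - nu)%:R / r%:R != 0 :> R.
  by move=> nur; rewrite mulf_neq0 ?invr_neq0 ?pnatr_eq0 ?subn_eq0 -?ltnNge// -lt0n.
(* Outside the range of summation the factor is set to 1: the lemmas on sums ask
   for a nonzero factor at every index. *)
pose K nu : R := if (nu < r)%N then (r - nu)%:R / r%:R else 1.
have KN0 nu : K nu != 0.
  by rewrite /K; case: ifPn => [/kN0//|_]; exact: oner_neq0.
have sumK F : \sum_(0 <= nu < r) (-1) ^+ nu * 'C(2 * r, nu)%:R * F ((r - nu)%:R / r%:R) =
    \sum_(0 <= nu < r) (-1) ^+ nu * 'C(2 * r, nu)%:R * F (K nu) :> R.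
  by rewrite !big_nat; apply: eq_bigr => nu /andP[_ nur]; rewrite /K nur.
rewrite (sumK (fun k => \int[mu]_(t in `[- (d / 2), d / 2]) f0 (x + k * t))).
have L nu : loc_integrable (fun t => f0 (x + K nu * t)) by exact: loc_integrable_affine.
rewrite -(Rintegral_sum _ _ _ _ L).
under eq_Rintegral => t _ do rewrite (sumK (fun k => f (x + k * t))).
apply: Rintegral_null_eq => //.
  have [] // := @loc_integrable_sum R _ (index_iota 0 r) _
    (fun nu => loc_integrableZ ((-1) ^+ nu * 'C(2 * r, nu)%:R) (L nu)).
apply: (@null_eq_sum R _ (index_iota 0 r)) => nu.
apply: (null_eq_comp (fun y => (-1) ^+ nu * 'C(2 * r, nu)%:R * y)).
exact: null_eq_affine.
Qed.

Lemma steklovB d r f g f0 g0 x : (0 < r)%N -> loc_integrable f0 -> null_eq f f0 ->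
  loc_integrable g0 -> null_eq g g0 ->
  steklov d r f x - steklov d r g x = steklov d r (fun y => f y - g y) x.
Proof.
move=> r0 lf ff lg gg.
have lfg := loc_integrableB lf lg.
have fgfg : null_eq (fun y => f y - g y) (fun y => f0 y - g0 y).
  exact: (null_eq_comp2 (fun a b : R => a - b) ff gg).
rewrite (steklovE _ _ r0 lf ff) (steklovE _ _ r0 lg gg) (steklovE _ _ r0 lfg fgfg).
rewrite -mulrBr -sumrB; congr (_ * _); rewrite !big_nat; apply: eq_bigr => nu /andP[_ nur].
rewrite -mulrBr; congr (_ * _).
have kN0 : (r - nu)%:R / r%:R != 0 :> R.
  by rewrite mulf_neq0 ?invr_neq0 ?pnatr_eq0 ?subn_eq0 -?ltnNge// -lt0n.
rewrite -RintegralB//.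
- by have [_] := loc_integrable_affine x kN0 lf; exact.
- by have [_] := loc_integrable_affine x kN0 lg; exact.
Qed.

(** Each dilation factor (r - nu) / r lies between 1/r and 1, so the substitution
    keeps the window inside [x - d/2, x + d/2] and costs a factor at most r. *)
Lemma steklov_le d r f f0 x : (0 < r)%N -> 0 < d -> loc_integrable f0 -> null_eq f f0 ->
  `|steklov d r f x| <= (2 * r%:R * \sum_(0 <= nu < r) 'C(2 * r, nu)%:R) *
     (d^-1 * \int[mu]_(t in `[x - d / 2, x + d / 2]) `|f0 t|).
Proof.
move=> r0 d0 lf ff; rewrite (steklovE _ _ r0 lf ff).
pose J := \int[mu]_(t in `[x - d / 2, x + d / 2]) `|f0 t|; rewrite -/J.
have rp : 0 < r%:R :> R by rewrite ltr0n.
have J0 : 0 <= J by exact: Rintegral_ge0.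
have key nu : (nu < r)%N ->
    `|\int[mu]_(t in `[- (d / 2), d / 2]) f0 (x + (r - nu)%:R / r%:R * t)| <= r%:R * J.
  move=> nur; set k := _ / _.
  have k0 : 0 < k by rewrite /k divr_gt0// ltr0n subn_gt0.
  have k1 : k <= 1 by rewrite /k ler_pdivrMr// mul1r ler_nat leq_subr.
  have rk : r%:R * k >= 1.
    by rewrite /k mulrC divfK ?gt_eqF// ler1n subn_gt0.
  have lk := loc_integrable_affine x (lt0r_neq0 k0) lf.
  apply: (@le_trans _ _ (\int[mu]_(t in `[- (d / 2), d / 2]) `|f0 (x + k * t)|)).
    by apply: le_normr_Rintegral => //; have [_] := lk; exact.
  rewrite (@Rintegral_affine_itv _ (fun y => `|f0 y|))//; last exact: loc_integrable_abs.
  rewrite ler_pdivrMl// (@le_trans _ _ J)//.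
    apply: le_Rintegral_abs_sub => //.
      by rewrite lerD2l mulrN lerN2 ler_piMl// divr_ge0// ltW.
    by rewrite lerD2l ler_piMl// divr_ge0// ltW.
  by rewrite mulrA ler_peMl// mulrC.
rewrite normrM normrM -[leRHS]mulrA.
have dd : `|2 / d| = 2 * d^-1 by rewrite ger0_norm// divr_ge0// ltW.
rewrite dd.
apply: (@le_trans _ _ (1 * (2 * d^-1) * (\sum_(0 <= nu < r) 'C(2 * r, nu)%:R * (r%:R * J)))).
  apply: ler_pM => //.
  - by rewrite mulr_ge0// mulr_ge0// invr_ge0 ltW.
  - by rewrite ler_wpM2r ?steklov_coef_norm// mulr_ge0// invr_ge0 ltW.
  apply: (le_trans (ler_norm_sum _ _ _)); rewrite !big_nat; apply: ler_sum => nu /andP[_ nur].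
  rewrite normrM normrM normrX normrN1 expr1n mul1r normr_nat.
  by rewrite ler_wpM2l// key.
by rewrite -mulr_suml le_eqVlt; apply/orP; left; apply/eqP; ring.
Qed.

End steklov_theory.

(** * Steklov averages of Sobolev functions *)

Section steklov_sobolev.
Context {R : realType}.
Notation mu := (@lebesgue_measure R).
Implicit Types (f g u : R -> R) (x t d : R).

(** The terms nu and 2r - nu of the difference centred at x have equal coefficients;
    the Steklov average collects the terms nu < r, and the middle term nu = r is a multiple
    of g(x). *)
Lemma difference_symmetric (r : nat) g x t : (0 < r)%N ->
  let S t := \sum_(0 <= nu < r) ((-1) ^+ nu * 'C(2 * r, nu)%:R) *
     g (x + (r - nu)%:R / r%:R * t) in
  difference (2 * r) (t / r%:R) g (x - t) =
  S t + S (- t) + (-1) ^+ r * 'C(2 * r, r)%:R * g x.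
Proof.
move=> r0 S; have rN0 : r%:R != 0 :> R by rewrite pnatr_eq0 -lt0n.
have r2 : (r <= 2 * r)%N by rewrite leq_pmull.
rewrite /difference (@big_cat_nat _ _ _ r)//=; last exact: leqW.
rewrite [X in _ + X]big_ltn ?ltnS// addrCA addrC; congr (_ + _ + _).
- rewrite /S !big_nat; apply: eq_bigr => nu /andP[_ nur].
  rewrite [_%:R * _ ^+ _]mulrC; congr (_ * g _).
  rewrite !natrB ?(ltnW nur)//; last by rewrite (leq_trans (ltnW nur)).
  by rewrite natrM; field.
- rewrite -{1}[r.+1]add0n big_addn subSS mul2n -addnn addnK big_nat_rev/=.
  rewrite /S !big_nat; apply: eq_bigr => nu /andP[_ nur].
  have -> : (0 + r - nu.+1 + r.+1 = r + r - nu)%N.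
    by rewrite add0n addnS -addSn subnSK// addnBAC// ltnW.
  have nur2 : (nu <= r + r)%N by rewrite (leq_trans (ltnW nur))// leq_addr.
  rewrite bin_sub// [_%:R * _ ^+ _]mulrC; congr (_ * _ * g _).
    by rewrite -signr_odd oddB// addnn odd_double/= signr_odd.
    by rewrite mul2n -addnn.
  by rewrite subKn// natrB ?(ltnW nur)//; field.
- rewrite [_%:R * _ ^+ _]mulrC; congr (_ * g _).
  by rewrite mul2n -addnn addnK; field.
Qed.

(** Integrating [difference_symmetric] over the symmetric window shows that the
    error is a bounded multiple of the mean of the symmetric difference of order 2r.  The
    2r - (k + 1) excess differences are bounded trivially by powers of 2, and the remaining
    ones by [difference_le_integral]. *)
Lemma steklov_sub_le (k r : nat) g g0 x d :
  (forall i, (i < k)%N -> forall x, derivable g^`(i)%classic x 1) ->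
  (forall a b, abs_continuous_on a b g^`(k)%classic) -> continuous g ->
  loc_integrable g0 -> null_eq g^`(k.+1)%classic g0 ->
  (0 < r)%N -> (k.+1 <= 2 * r)%N -> 0 < d ->
  `|steklov d r g x - g x| <=
  2 ^+ (2 * r) * d ^+ k * \int[mu]_(t in `[x - d / 2, x + d / 2]) `|g0 t|.
Proof.
move=> dg acg cg lg0 gg0 r0 kr d0.
have lg := continuous_loc_integrable cg.
have rp : 0 < r%:R :> R by rewrite ltr0n.
pose J := \int[mu]_(t in `[x - d / 2, x + d / 2]) `|g0 t|; rewrite -/J.
have J0 : 0 <= J by exact: Rintegral_ge0.
pose S t := \sum_(0 <= nu < r) ((-1) ^+ nu * 'C(2 * r, nu)%:R) *
     g (x + (r - nu)%:R / r%:R * t).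
pose T t := difference (2 * r) (t / r%:R) g (x - t).
have lgk q : loc_integrable (fun t => g (x + q * t)).
  apply: continuous_loc_integrable => t; apply: continuous_comp; last exact: cg.
  by apply: cvgD; [exact: cvg_cst|apply: cvgM; [exact: cvg_cst|exact: cvg_id]].
have lS : loc_integrable S.
  apply: (@loc_integrable_sum R _ (index_iota 0 r)) => nu.
  exact: (loc_integrableZ ((-1) ^+ nu * 'C(2 * r, nu)%:R) (lgk ((r - nu)%:R / r%:R))).
have lS' : loc_integrable (fun t => S (- t)).
  have N1 : (-1 : R) != 0 by rewrite oppr_eq0 oner_neq0.
  have := loc_integrable_affine 0 N1 lS.
  by under eq_fun do rewrite add0r mulN1r.
pose w := (-1) ^+ r * 'C(2 * r, r)%:R * g x.
have TE t : T t = S t + S (- t) + w by exact: difference_symmetric.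
have lT : loc_integrable T.
  rewrite (funext TE).
  exact: (loc_integrableD (loc_integrableD lS lS') (loc_integrable_cst w)).
pose D := `[- (d / 2), d / 2]%classic : set (measurableTypeR R).
have mD : measurable D by exact: measurable_itv.
have muD : mu D = d%:E.
  rewrite /D lebesgue_measure_itv/= lte_fin; case: ifPn => [_|/negP[]]; last lra.
  by rewrite -EFinB; congr EFin; lra.
have intT : \int[mu]_(t in D) T t = 2 * \int[mu]_(t in D) S t + w * d.
  under eq_Rintegral do rewrite TE.
  rewrite RintegralD//; last 2 first.
  - by have [_] := loc_integrableD lS lS'; exact.
  - by have [_] := loc_integrable_cst w; exact.
  rewrite RintegralD//; last 2 first.
  - by have [_] := lS; exact.
  - by have [_] := lS'; exact.
  by rewrite Rintegral_opp_itv// Rintegral_cst//= muD/= mulr_natl mulr2n.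
have stE : steklov d r g x - g x = steklov_coef r * d^-1 * \int[mu]_(t in D) T t.
  rewrite (steklovE _ _ r0 lg (null_eq_refl g)).
  rewrite -(@Rintegral_sum R _ _ _ (fun nu t => g (x + (r - nu)%:R / r%:R * t))) //=.
  rewrite -/D -[\int[mu]_(t in D) _]/(\int[mu]_(t in D) S t) intT mulrDr.
  have cw : steklov_coef r * d^-1 * (w * d) = - g x.
    have C0 : 'C(2 * r, r)%:R != 0 :> R.
      by rewrite pnatr_eq0 -lt0n bin_gt0 leq_pmull.
    rewrite /steklov_coef /w exprS.
    have e2 : (-1) ^+ r * (-1) ^+ r = 1 :> R by rewrite -exprD addnn -signr_odd odd_double.
    transitivity (- ((-1) ^+ r * (-1) ^+ r) * g x); last by rewrite e2 mulN1r.
    by field; rewrite C0/= gt_eqF.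
  by rewrite cw; congr (_ - _); ring.
have TJ t : - (d / 2) <= t <= d / 2 -> `|T t| <= 2 ^+ (2 * r) * d ^+ k * J.
  move=> /andP[td1 td2].
  have pos i : (i <= 2 * r)%N -> x - d / 2 <= x - t + i%:R * (t / r%:R) <= x + d / 2.
    move=> ir; have -> : i%:R * (t / r%:R) = (i%:R / r%:R) * t by rewrite mulrA mulrAC.
    have q0 : 0 <= i%:R / r%:R :> R by rewrite divr_ge0.
    have q2 : i%:R / r%:R <= 2 :> R by rewrite ler_pdivrMr// -natrM ler_nat.
    move: (i%:R / r%:R) q0 q2 => q q0 q2.
    have [t0|t0] := leP 0 t.
      have qt : 0 <= q * t by exact: mulr_ge0.
      have qt2 : q * t <= 2 * t by exact: ler_wpM2r.
      by apply/andP; split; lra.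
    have qt : q * t <= 0 by exact: mulr_ge0_le0 (ltW t0).
    have qt2 : 2 * t <= q * t by rewrite ler_wnM2r// ltW.
    by apply/andP; split; lra.
  pose m := (2 * r - k.+1)%N.
  have rE : (2 * r = m + k.+1)%N by rewrite /m subnK.
  rewrite /T {1}rE difference_add.
  have etad : `|t / r%:R| <= d.
    rewrite normrM normfV (ger0_norm (ltW rp)) ler_pdivrMr//.
    rewrite (@le_trans _ _ (d * 1))//; last by rewrite ler_wpM2l ?(ltW d0)// ler1n.
    by rewrite mulr1 ler_norml; apply/andP; split; lra.
  apply: (@le_trans _ _ (2 ^+ m * (`|t / r%:R| ^+ k * J))).
    apply: difference_le => j jm.
    apply: (difference_le_integral dg acg lg0 gg0).
    - by have /pos/andP[] : (j <= 2 * r)%N by rewrite rE (leq_trans jm)// leq_addr.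
    - by have /pos/andP[] : (j <= 2 * r)%N by rewrite rE (leq_trans jm)// leq_addr.
    - have /pos/andP[H _] : (j + k.+1 <= 2 * r)%N by rewrite rE leq_add2r.
      by rewrite -addrA -mulrDl -natrD.
    - have /pos/andP[_ H] : (j + k.+1 <= 2 * r)%N by rewrite rE leq_add2r.
      by rewrite -addrA -mulrDl -natrD.
  rewrite -[leRHS]mulrA; apply: ler_pM => //.
  - by rewrite mulr_ge0// exprn_ge0.
  - by rewrite ler_weXn2l ?ler1n// rE leq_addr.
  - by rewrite ler_wpM2r// lerXn2r// nnegrE// ltW.
rewrite stE normrM normrM.
apply: (@le_trans _ _ (1 * d^-1 * (2 ^+ (2 * r) * d ^+ k * J * d))); last first.
  by rewrite le_eqVlt; apply/orP; left; apply/eqP; field; exact: lt0r_neq0.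
apply: ler_pM => //.
  by rewrite ler_pM// ?steklov_coef_norm// normfV gtr0_norm.
apply: (le_trans (le_normr_Rintegral mD _)); first by have [_] := lT; exact.
have labs := loc_integrable_abs lT.
have := @le_Rintegral _ _ _ mu D (fun t => `|T t|) (fun=> 2 ^+ (2 * r) * d ^+ k * J) mD.
rewrite Rintegral_cst//= muD/=; apply.
- by have [_] := labs; exact.
- by have [_] := loc_integrable_cst (2 ^+ (2 * r) * d ^+ k * J); exact.
- by move=> t; rewrite /D/= in_itv/=; exact: TJ.
Qed.

End steklov_sobolev.

(** * Moving averages *)

Section average.
Context {R : realType}.
Notation mu := (@lebesgue_measure R).
Implicit Types (f g u : R -> R) (a b c h x y t v : R) (k s : nat).

Definition average a f x : R := a^-1 * \int[mu]_(t in `[x, x + a]) f t.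

Lemma average_primitive a c f y : loc_integrable f -> 0 < a -> c <= y ->
  average a f y = a^-1 * (parameterized_integral mu c (y + a) f
                          - parameterized_integral mu c y f).
Proof.
move=> [mf lf] a0 cy; congr (_ * _); rewrite /parameterized_integral.
rewrite (@Rintegral_itvB _ _ (BLeft c) (BRight (y + a)))//.
- rewrite Rintegral_itv_obnd_cbnd//.
  by apply: integrableS (lf y (y + a)) => //; apply: subset_itvr; rewrite bnd_simp.
- by rewrite bnd_simp lerDl ltW.
Qed.

Lemma primitive_continuous c f y : loc_integrable f -> c < y ->
  {for y, continuous (fun y => parameterized_integral mu c y f)}.
Proof.
move=> [mf lf] cy.
have cy1 : c <= y + 1 by lra.
have /continuous_within_itvP := parameterized_integral_continuous cy1 (lf c (y + 1)).
have cy1' : c < y + 1 by lra.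
move=> /(_ cy1')[H _ _]; apply: H.
suff: y \in `]c, y + 1[%R by []. by rewrite in_itv /= cy ltrDl ltr01.
Qed.

Lemma average_continuous a f : 0 < a -> loc_integrable f -> continuous (average a f).
Proof.
move=> a0 lf x.
have P z : x - 1 < z -> {for z, continuous (fun y => parameterized_integral mu (x - 1) y f)}.
  exact: primitive_continuous.
suff H : {for x, continuous (fun y => a^-1 * (parameterized_integral mu (x - 1) (y + a) f
                          - parameterized_integral mu (x - 1) y f))}.
  apply: cvg_trans; last first.
    rewrite (average_primitive (c := x - 1) lf a0); last lra.
    exact: H.
  apply: near_eq_cvg; near=> y; apply/esym/average_primitive => //.
  by apply: ltW; near: y; apply: lt_nbhsr; lra.
apply: cvgM; first exact: cvg_cst.
apply: cvgB; last by apply: P; lra.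
have := @continuous_comp _ _ _ (fun y => y + a) (fun y => parameterized_integral mu (x - 1) y f) x.
apply; last by apply: P; lra.
by apply: cvgD; [exact: cvg_id|exact: cvg_cst].
Unshelve. all: by end_near. Qed.

(** The fundamental theorem of calculus at both ends of the window. *)
Lemma is_derive_average a f x : 0 < a -> continuous f ->
  is_derive x (1 : R) (average a f) (a^-1 * (f (x + a) - f x)).
Proof.
move=> a0 cf; have lf := continuous_loc_integrable cf.
pose P y := parameterized_integral mu (x - 1) y f.
have dP z : x - 1 < z -> is_derive z (1 : R) P (f z).
  move=> xz; have [] := @continuous_FTC1_closed R f (x - 1) z (z + 1) _ _ xz (cf z).
  - by rewrite ltrDl.
  - by have [_] := lf; exact.
  by move=> dF F'; rewrite -F' derive1E; exact: derivableP.
have d1 : is_derive x (1 : R) (fun y => P (y + a)) (f (x + a)).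
  by apply: is_derive1_shift; apply: dP; lra.
have d2 : is_derive x (1 : R) P (f x) by apply: dP; lra.
have d3 : is_derive x (1 : R) (a^-1 *: ((fun y => P (y + a)) - P)) (a^-1 *: (f (x + a) - f x)).
  by apply: is_deriveZ; exact: is_deriveB.
apply: near_eq_is_derive d3.
near=> y.
rewrite (average_primitive (c := x - 1) lf a0)//.
by apply: ltW; near: y; apply: lt_nbhsr; lra.
Unshelve. all: by end_near. Qed.

Lemma average_sum (I : Type) (r : seq I) (c : I -> R) (F : I -> R -> R) a x :
  (forall i, loc_integrable (F i)) ->
  average a (fun y => \sum_(i <- r) c i * F i y) x = \sum_(i <- r) c i * average a (F i) x.
Proof.
move=> lF; rewrite /average Rintegral_sum// mulr_sumr.
by apply: eq_bigr => i _; rewrite mulrCA.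
Qed.

Lemma average_affine a c b f v : 0 < b -> loc_integrable f ->
  average a (fun v => f (c + b * v)) v = average (b * a) f (c + b * v).
Proof.
move=> k_gt0 lf; rewrite /average Rintegral_affine_itv// mulrA invfM [a^-1 * _]mulrC.
by rewrite mulrDr addrA.
Qed.

Lemma average_shift a c f x : loc_integrable f ->
  average a (fun y => f (y + c)) x = average a f (x + c).
Proof.
move=> lf; have := average_affine a c x ltr01 lf; rewrite !mul1r addrC => <-.
by congr average; apply/funext => y; rewrite mul1r addrC.
Qed.

Lemma average_cst a c : 0 < a -> average a (fun=> c) = fun=> c.
Proof.
move=> a0; apply/funext => x; rewrite /average Rintegral_cst//= lebesgue_measure_itv/=.
rewrite lte_fin ltrDl a0 -EFinB/= addrAC subrr add0r mulrC mulfK// gt_eqF//.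
Qed.

Lemma average_periodic a f : loc_integrable f -> periodic f 1 -> periodic (average a f) 1.
Proof.
move=> lf pf x; rewrite -average_shift//; congr average.
by apply/funext => y; rewrite pf.
Qed.

Lemma average_norm_le a f x : 0 < a -> loc_integrable f ->
  `|average a f x| <= a^-1 * \int[mu]_(t in `[x, x + a]) `|f t|.
Proof.
move=> a0 lf; have ai : 0 <= a^-1 by rewrite invr_ge0 ltW.
rewrite /average normrM ger0_norm// ler_wpM2l// le_normr_Rintegral//.
by have [_] := lf; exact.
Qed.

Lemma average_bounded a f x M : 0 < a -> loc_integrable f ->
  (forall t, x <= t <= x + a -> `|f t| <= M) -> `|average a f x| <= M.
Proof.
move=> a0 lf fM; have ai : 0 <= a^-1 by rewrite invr_ge0 ltW.
apply: (le_trans (average_norm_le x a0 lf)).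
have labs := loc_integrable_abs lf.
have -> : M = average a (fun=> M) x by rewrite average_cst.
rewrite /average ler_wpM2l//; apply: le_Rintegral => //.
- by have [_] := labs; exact.
- by have [_] := loc_integrable_cst M; exact.
Qed.

Lemma iter_average_continuous k a f : 0 < a -> loc_integrable f ->
  continuous (iter k.+1 (average a) f).
Proof.
move=> a0 lf; elim: k => [|k IHk]; first exact: average_continuous.
by rewrite iterS; apply: average_continuous => //; exact: continuous_loc_integrable.
Qed.

Lemma iter_average_loc k a f : 0 < a -> loc_integrable f ->
  loc_integrable (iter k (average a) f).
Proof.
case: k => [//|k] a0 lf; apply: continuous_loc_integrable.
exact: iter_average_continuous.
Qed.

Lemma iter_average_sum (I : Type) (r : seq I) (c : I -> R) (F : I -> R -> R) k a :
  0 < a -> (forall i, loc_integrable (F i)) ->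
  iter k (average a) (fun y => \sum_(i <- r) c i * F i y) =
  fun x => \sum_(i <- r) c i * iter k (average a) (F i) x.
Proof.
move=> a0 lF; elim: k => [//|k IHk]; rewrite iterS IHk; apply/funext => x.
by rewrite average_sum// => i; exact: iter_average_loc.
Qed.

Lemma iter_average_affine k a c b f : 0 < a -> 0 < b -> loc_integrable f ->
  iter k (average a) (fun v => f (c + b * v)) =
  fun v => iter k (average (b * a)) f (c + b * v).
Proof.
move=> a0 k_gt0 lf; elim: k => [//|k IHk]; rewrite iterS IHk; apply/funext => x.
by rewrite average_affine//; apply: iter_average_loc => //; exact: mulr_gt0.
Qed.

Lemma iter_average_cst k a c : 0 < a -> iter k (average a) (fun=> c) = fun=> c.
Proof. by move=> a0; elim: k => [//|k IHk]; rewrite iterS IHk average_cst. Qed.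

Lemma iter_average_periodic k a f : 0 < a -> loc_integrable f -> periodic f 1 ->
  periodic (iter k (average a) f) 1.
Proof.
move=> a0 lf pf; elim: k => [//|k IHk].
by rewrite iterS; apply: average_periodic => //; exact: iter_average_loc.
Qed.

(** All but one of the averages are bounded by the supremum; the support of the iterated
    average starting at v is [v, v + (k + 1) a]. *)
Lemma iter_average_le k a f H v : 0 < a -> loc_integrable f ->
  0 <= v -> v + k.+1%:R * a <= H ->
  `|iter k.+1 (average a) f v| <= a^-1 * \int[mu]_(t in `[0, H]) `|f t|.
Proof.
move=> a0 lf; have ai : 0 <= a^-1 by rewrite invr_ge0 ltW.
elim: k v => [|k IHk] v v0 vH.
  apply: (le_trans (average_norm_le v a0 lf)).
  rewrite ler_wpM2l//; apply: le_Rintegral_abs_sub => //.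
  by rewrite mul1r in vH.
rewrite iterS; apply: average_bounded => //; first exact: iter_average_loc.
move=> t /andP[vt tv]; apply: IHk; first exact: le_trans vt.
by rewrite -[k.+2%:R]natr1 mulrDl mul1r in vH; lra.
Qed.

End average.

(** * A smooth approximation built from moving averages *)

Section smoothing.
Context {R : realType}.
Notation mu := (@lebesgue_measure R).
Implicit Types (f g : R -> R) (a b h x : R) (i k s : nat).

(** The parameter i is the order of derivative: [smoothing s a 0 f] is the approximation
    itself and [smoothing s a i f] is its i-th derivative in closed form.  One average per
    derivative is consumed, and one is left when i = s so that the last derivative is continuous. *)
Definition smoothing s a i f x : R :=
  \sum_(nu < s) ((-1) ^+ s.+1 * ('C(s, nu)%:R * (-1) ^+ nu) * ((s - nu)%:R * a) ^- i) *
    difference i ((s - nu)%:R * a) (iter (s.+1 - i) (average ((s - nu)%:R * a)) f) x.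

(** One of the s + 1 - i averages is differentiated and becomes a difference quotient,
    which raises the order of the difference by one. *)
Lemma is_derive_smoothing s a i f x : 0 < a -> loc_integrable f -> (i < s)%N ->
  is_derive x (1 : R) (smoothing s a i f) (smoothing s a i.+1 f x).
Proof.
move=> a0 lf lis; rewrite /smoothing.
pose c (nu : 'I_s) : R := (-1) ^+ s.+1 * ('C(s, nu)%:R * (-1) ^+ nu).
pose b (nu : 'I_s) : R := (s - nu)%:R * a.
have b0 nu : 0 < b nu by rewrite mulr_gt0// ltr0n subn_gt0.
pose F nu := difference i (b nu) (iter (s.+1 - i) (average (b nu)) f).
pose F' nu x := (b nu)^-1 * difference i.+1 (b nu) (iter (s - i) (average (b nu)) f) x.
have dF nu : is_derive x (1 : R) (F nu) (F' nu x).
  rewrite /F /F' subSn ?(ltnW lis)// iterS differenceSr.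
  set u := iter (s - i) _ f.
  have cu : continuous u.
    by rewrite /u -(prednK (n := s - i)) ?subn_gt0//; exact: iter_average_continuous.
  have -> : (b nu)^-1 * difference i (b nu) (fun y => u (y + b nu) - u y) x =
    difference i (b nu) (fun y => (b nu)^-1 * (u (y + b nu) - u y)) x.
    rewrite /difference mulr_sumr; apply: eq_bigr => k _; ring.
  by apply: is_derive_difference => y; exact: is_derive_average.
have := @is_derive_sum _ _ _ s (fun nu => (c nu * b nu ^- i) *: F nu) x 1
  (fun nu => (c nu * b nu ^- i) *: F' nu x) (fun nu => is_deriveZ _ (dF nu)).
congr (is_derive _ _ _ _).
  by apply/funext => y; rewrite fct_sumE.
apply: eq_bigr => nu _; rewrite /F' -[_ *: _]/(_ * _) subSS.
suff E : c nu / b nu ^+ i / b nu = c nu / b nu ^+ i.+1 by rewrite [LHS]mulrA E.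
by rewrite exprS; field; rewrite expf_neq0 ?gt_eqF.
Qed.

Lemma smoothing_derive s a i f : 0 < a -> loc_integrable f -> (i <= s)%N ->
  (smoothing s a 0 f)^`(i)%classic = smoothing s a i f.
Proof.
move=> a0 lf; elim: i => [//|i IHi] lis; rewrite derive1nS IHi ?(ltnW lis)//.
apply/funext => x; rewrite derive1E.
by have := is_derive_smoothing x a0 lf lis; move/@derive_val.
Qed.

Lemma smoothing_continuous s a i f : 0 < a -> loc_integrable f -> (i <= s)%N ->
  continuous (smoothing s a i f).
Proof.
move=> a0 lf lis x.
rewrite /smoothing; apply: cvg_big => [|nu _]; first exact: add_continuous.
apply: cvgM; first exact: cvg_cst.
rewrite /difference; apply: cvg_big => [|k _]; first exact: add_continuous.
apply: cvgM; first exact: cvg_cst.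
have b0 : 0 < (s - nu)%:R * a by rewrite mulr_gt0// ltr0n subn_gt0.
rewrite subSn//; set c := (i - k)%:R * _.
have := @continuous_comp _ _ _ (fun y => y + c)
  (iter (s - i).+1 (average ((s - nu)%:R * a)) f) x.
apply; last exact: iter_average_continuous.
by apply: cvgD; [exact: cvg_id|exact: cvg_cst].
Qed.

Lemma difference_periodic s h f : periodic f 1 -> periodic (difference s h f) 1.
Proof.
by move=> pf x; apply: eq_bigr => k _; rewrite addrAC pf.
Qed.

Lemma smoothing_periodic s a i f : 0 < a -> loc_integrable f -> periodic f 1 ->
  periodic (smoothing s a i f) 1.
Proof.
move=> a0 lf pf x; apply: eq_bigr => nu _; congr (_ * _).
apply: difference_periodic; apply: iter_average_periodic => //.
by rewrite mulr_gt0// ltr0n subn_gt0.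
Qed.

(** The term nu of Delta_v^s f(x) is a multiple of f(x + (s - nu) v); averaging it in v
    with width a at 0 amounts to averaging f with width (s - nu) a at x.  The term
    nu = s is the constant (-1)^s f(x). *)
Lemma smoothingE s a f x : 0 < a -> loc_integrable f ->
  f x - smoothing s a 0 f x =
  (-1) ^+ s * iter s.+1 (average a) (fun v => difference s v f x) 0.
Proof.
move=> a0 lf.
pose F (k : nat) (v : R) := f (x + (s - k)%:R * v).
have lF k : loc_integrable (F k).
  rewrite /F; have [->|H] := eqVneq (s - k)%N 0%N.
    by under eq_fun do rewrite mul0r; exact: loc_integrable_cst.
  by apply: loc_integrable_affine => //; rewrite pnatr_eq0.
have Fs : F s = fun=> f x by apply/funext => v; rewrite /F subnn mul0r addr0.
rewrite /difference (iter_average_sum _ _ _ a0 lF)//.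
rewrite [X in _ * X](_ : _ = \sum_(0 <= k < s)
    'C(s, k)%:R * (-1) ^+ k * iter s.+1 (average a) (F k) 0 + (-1) ^+ s * f x); last first.
  by rewrite big_nat_recr//= Fs -[average a _]/(iter s.+1 _ _) iter_average_cst// binn mul1r.
rewrite mulrDr mulrA -exprD addnn -muln2 mulnC exprM sqrrN expr1n.
rewrite expr1n mul1r [RHS]addrC; congr (_ + _).
rewrite /smoothing big_mkord mulr_sumr -sumrN; apply: eq_bigr => nu _.
have b0 : 0 < ((s - nu)%:R : R) by rewrite ltr0n subn_gt0.
rewrite iter_average_affine// mulr0 addr0 difference0 subn0 expr0 invr1 mulr1.
by rewrite exprS mulN1r mulNr mulNr opprK mulrA.
Qed.

Lemma smoothing_sub_le s a f x : (0 < s)%N -> 0 < a -> loc_integrable f ->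
  `|f x - smoothing s a 0 f x| <=
  a^-1 * \int[mu]_(v in `[0, s.+1%:R * a]) `|difference s v f x|.
Proof.
move=> s0 a0 lf; rewrite smoothingE// normrM normrX normrN1 expr1n mul1r.
apply: iter_average_le => //; last by rewrite add0r.
apply: loc_integrable_sum => k; apply: loc_integrableZ.
have [->|H] := eqVneq (s - k)%N 0%N.
  by under eq_fun do rewrite mul0r; exact: loc_integrable_cst.
by apply: loc_integrable_affine => //; rewrite pnatr_eq0.
Qed.

(** A continuous derivative is bounded on [a, b], so the function is Lipschitz there. *)
Lemma C1_abs_continuous (g g' : R -> R) :
  (forall x, is_derive x (1 : R) g (g' x)) -> continuous g' ->
  forall a b, abs_continuous_on a b g.
Proof.
move=> dg cg' a b.
have [ab|ba] := leP a b; last first.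
  move=> e e0; exists 1 => // m u v uv _ _; rewrite big1// => i _.
  have [au uv' vb] := uv i.
  by have : a <= b := le_trans au (le_trans uv' vb); rewrite leNgt ba.
have cg : continuous g.
  by move=> x; apply/differentiable_continuous/derivable1_diffP; have [] := dg x.
have cn : {within `[a, b], continuous (fun x => `|g' x|)}.
  apply: continuous_subspaceT => x.
  by apply: (@continuous_comp _ _ _ g' (fun y => `|y|)); [exact: cg'|exact: norm_continuous].
have [c _ cmax] := EVT_max ab cn.
pose M := `|g' c| + 1; have M0 : 0 < M by rewrite ltr_wpDl.
move=> e e0; exists (e / M); first exact: divr_gt0.
move=> m u v uv _ uve; rewrite ltr_pdivlMr// in uve.
apply: le_lt_trans uve; rewrite mulr_suml; apply: ler_sum => i _.
have [au uv' vb] := uv i.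
have [z /[!in_itv]/= /andP[uz zv] ->] := MVT_segment uv' (fun x _ => dg x)
  (continuous_subspaceT cg).
rewrite normrM [`|v i - u i|]ger0_norm ?subr_ge0// mulrC ler_wpM2l ?subr_ge0//.
rewrite (le_trans (cmax z _)) ?lerDl//.
by rewrite in_itv/= (le_trans au uz) (le_trans zv vb).
Qed.

End smoothing.

(** * Norm estimates by the modulus of smoothness *)

Section norm_bounds.
Context {R : realType}.
Notation mu := (@lebesgue_measure R).
Implicit Types (f g : R -> R) (a b h x p : R) (k s : nat) (B : \bar R).

Lemma measurable_affine_pair f c : measurable_fun setT f ->
  measurable_fun setT (fun z : R * R => f (z.1 + c * z.2)).
Proof.
move=> mf; apply: measurableT_comp => //; apply: measurable_funD => //.
by apply: measurable_funM => //.
Qed.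

Lemma measurable_shift f c : measurable_fun setT f -> measurable_fun setT (fun x => f (x + c)).
Proof. by move=> mf; apply: measurableT_comp => //; exact: measurable_funD. Qed.

Lemma measurable_difference s h f : measurable_fun setT f ->
  measurable_fun setT (difference s h f).
Proof.
move=> mf; apply: measurable_sum => k; apply: measurable_funM => //.
exact: measurable_shift.
Qed.

Lemma sum_binomial s : (\sum_(k < s.+1) 'C(s, k) = 2 ^ s)%N.
Proof.
have := expnDn 1 1 s; rewrite addn1 => ->.
by apply: eq_bigr => k _; rewrite !exp1n !muln1.
Qed.

(** The coefficients of the difference have absolute sum 2^s, and translation preserves
    the norm. *)
Lemma period_norm_difference_le p s h f : 1 <= p -> measurable_fun setT f -> periodic f 1 ->
  (period_norm p (difference s h f) <= (2 ^+ s)%:E * period_norm p f)%E.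
Proof.
move=> p1 mf pf.
apply: le_trans (period_norm_sum _ _ p1 (fun k => measurable_shift _ mf)) _.
under eq_bigr do rewrite period_norm_shift//.
rewrite -ge0_sume_distrl// sumEFin lee_wpmul2r ?period_norm_ge0// lee_fin.
rewrite big_mkord -natrX -sum_binomial natr_sum.
by apply: ler_sum => k _; rewrite normrM normrX normrN1 expr1n mulr1 ger0_norm.
Qed.

Lemma average_shift_from0 a f x : loc_integrable f ->
  average a f x = average a (fun t => f (x + t)) 0.
Proof.
move=> lf; have := average_affine a x 0 ltr01 lf; rewrite mul1r mulr0 addr0 => <-.
by under eq_fun do rewrite mul1r.
Qed.

(** The average at x is an average of translates of f, and translation preserves the norm. *)
Lemma period_norm_average_le p a f : 1 <= p -> 0 < a -> loc_integrable f -> periodic f 1 ->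
  (period_norm p (average a f) <= period_norm p f)%E.
Proof.
move=> p1 a0 lf pf; have [mf _] := lf.
apply: (period_norm_average (h := a) (u := fun x t => f (x + t))) => //.
- exact: period_norm_ge0.
- have := measurable_affine_pair 1 mf.
  by apply: eq_measurable_fun => z _; rewrite mul1r.
- by have [] := continuous_loc_integrable (average_continuous a0 lf).
- by move=> x; have [_] := loc_integrable_shift x lf; exact.
- move=> x; rewrite average_shift_from0//.
  have := average_norm_le 0 a0 (loc_integrable_shift x lf).
  by rewrite add0r.
- by move=> t _; rewrite period_norm_shift.
Qed.

Lemma difference_average s h a f x : loc_integrable f ->
  difference s h (average a f) x = average a (difference s h f) x.
Proof.
move=> lf; rewrite {2}/difference.
rewrite (average_sum _ _ (F := fun k y => f (y + (s - k)%:R * h))); last first.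
  by move=> k; under eq_fun do rewrite addrC; exact: loc_integrable_shift.
by apply: eq_bigr => k _; rewrite average_shift.
Qed.

Lemma loc_integrable_difference s h f : loc_integrable f ->
  loc_integrable (difference s h f).
Proof.
move=> lf; apply: loc_integrable_sum => k; apply: loc_integrableZ.
by under eq_fun do rewrite addrC; exact: loc_integrable_shift.
Qed.

Lemma loc_integrable_difference_step s f x : loc_integrable f ->
  loc_integrable (fun h => difference s h f x).
Proof.
move=> lf; apply: loc_integrable_sum => k; apply: loc_integrableZ.
have [->|H] := eqVneq (s - k)%N 0%N.
  by under eq_fun do rewrite mul0r; exact: loc_integrable_cst.
by apply: loc_integrable_affine => //; rewrite pnatr_eq0.
Qed.

(** The derivative of order s is a combination of b^-s times the averages of
    Delta_b^s f, where b = (s - nu) a >= a. *)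
Lemma period_norm_smoothing_derive p s a d f B : 1 <= p -> 0 < a -> s%:R * a < d ->
  loc_integrable f -> periodic f 1 -> (0 <= B)%E ->
  (forall h, 0 < h < d -> (period_norm p (difference s h f) <= B)%E) ->
  (period_norm p (smoothing s a s f) <= ((2 / a) ^+ s)%:E * B)%E.
Proof.
move=> p1 a0 sad lf pf B0 fB.
have b0 (nu : 'I_s) : 0 < (s - nu)%:R * a by rewrite mulr_gt0// ltr0n subn_gt0.
have ab (nu : 'I_s) : a <= (s - nu)%:R * a.
  by rewrite ler_peMl ?(ltW a0)// ler1n subn_gt0.
have bd (nu : 'I_s) : (s - nu)%:R * a < d.
  by apply: le_lt_trans sad; rewrite ler_wpM2r ?(ltW a0)// ler_nat leq_subr.
rewrite /smoothing subSnn.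
apply: le_trans (period_norm_sum _ _ p1 _) _.
  move=> nu; apply: measurable_difference.
  by have [] := continuous_loc_integrable (average_continuous (b0 nu) lf).
apply: (@le_trans _ _ (\sum_(nu < s) ('C(s, nu)%:R * a ^- s)%:E * B)%E).
  apply: lee_sum => nu _; apply: lee_pmul => //; first exact: period_norm_ge0.
    rewrite lee_fin normrM normrM normrM !normrX normrN1 !expr1n mul1r mulr1.
    rewrite normfV normrX !ger0_norm ?(ltW (b0 _))// ler_wpM2l//.
    by rewrite lef_pV2 ?posrE ?exprn_gt0// lerXn2r ?nnegrE ?(ltW (b0 _)) ?(ltW a0).
  rewrite (eq_period_norm _ (fun x => difference_average _ _ _ x lf)).
  apply: (le_trans _ (fB ((s - nu)%:R * a) _)); last by rewrite b0 bd.
  apply: period_norm_average_le => //; first exact: loc_integrable_difference.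
  exact: difference_periodic.
have ai : 0 <= a ^- s by rewrite invr_ge0 exprn_ge0// ltW.
rewrite -ge0_sume_distrl; last by move=> nu _; rewrite lee_fin mulr_ge0.
apply: lee_pmul => //.
  by rewrite sumEFin lee_fin sumr_ge0// => nu _; rewrite mulr_ge0.
rewrite sumEFin lee_fin -mulr_suml exprMn exprVn ler_wpM2r//.
rewrite -natrX -sum_binomial natr_sum big_ord_recr/= lerDl.
by [].
Qed.

(** The factor s + 1 appears because the integral over [0, (s + 1) a] in
    [smoothing_sub_le] is normalized by a instead of the length of the interval. *)
Lemma period_norm_smoothing_sub p s a d f B : 1 <= p -> (0 < s)%N -> 0 < a ->
  s.+1%:R * a < d -> loc_integrable f -> periodic f 1 -> (0 <= B)%E ->
  (forall h, 0 < h < d -> (period_norm p (difference s h f) <= B)%E) ->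
  (period_norm p (f \- smoothing s a 0 f)%R <= s.+1%:R%:E * B)%E.
Proof.
move=> p1 s0 a0 sad lf pf B0 fB; have [mf _] := lf.
have sa0 : 0 < s.+1%:R * a by rewrite mulr_gt0.
apply: (period_norm_average (h := s.+1%:R * a)
  (u := fun x v => s.+1%:R * difference s v f x)) => //.
- exact: mule_ge0.
- apply: measurable_funM => //; apply: measurable_sum => k; apply: measurable_funM => //.
  exact: measurable_affine_pair.
- apply: measurable_funB => //.
  by have [] := continuous_loc_integrable (smoothing_continuous a0 lf (leq0n s)).
- move=> x; have [_] := loc_integrableZ s.+1%:R (loc_integrable_difference_step s x lf).
  exact.
- move=> x /=; apply: (le_trans (smoothing_sub_le x s0 a0 lf)).
  have labs := loc_integrable_abs (loc_integrable_difference_step s x lf).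
  under [X in _ <= _ * X]eq_Rintegral do rewrite normrM.
  rewrite RintegralZl//; last by have [_] := labs; exact.
  rewrite (_ : a^-1 = (s.+1%:R * a)^-1 * s.+1%:R) ?ger0_norm ?mulrA//.
  by rewrite invfM mulrAC mulVf ?mul1r// pnatr_eq0.
- move=> t /andP[t0 ta]; rewrite period_normZ//; last exact: measurable_difference.
  by rewrite ger0_norm// lee_wpmul2l// ?lee_fin// fB// t0 (le_lt_trans ta).
Qed.

Lemma smoothing_Wsp p s a f : 1 <= p -> (0 < s)%N -> 0 < a -> loc_integrable f ->
  periodic f 1 -> (period_norm p (smoothing s a s f) < +oo)%E ->
  Wsp s p (smoothing s a 0 f).
Proof.
move=> p1 + a0 lf pf; case: s => [//|k] _ fin; split => /=.
- exact: smoothing_periodic.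
- move=> i ik x; rewrite smoothing_derive ?(leqW (ltnW ik))//.
  by have [] := is_derive_smoothing x a0 lf (leqW ik).
- move=> u v; rewrite smoothing_derive//.
  apply: (C1_abs_continuous (g' := smoothing k.+1 a k.+1 f)) => [x|].
    exact: is_derive_smoothing.
  exact: smoothing_continuous.
- rewrite -derive1nS smoothing_derive//.
  have ms : measurable_fun setT (smoothing k.+1 a k.+1 f).
    by have [] := continuous_loc_integrable (smoothing_continuous a0 lf (leqnn k.+1)).
  split; first exact: smoothing_periodic.
    exact: measurable_fun_lebesgueR.
  rewrite (normLp_period_norm _ ms (null_eq_refl _))//.
  by rewrite gt_eqF// (lt_le_trans ltr01).
Qed.

(** For each x the difference is dominated by the mean of s h^s |g^(s)| over
    [x, x + s h], an average of translates. *)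
Lemma period_norm_difference_Wsp p s h g g0 : 1 <= p -> (0 < s)%N -> 0 < h -> Wsp s p g ->
  measurable_fun setT g -> loc_integrable g0 -> periodic g0 1 ->
  null_eq g^`(s)%classic g0 ->
  (period_norm p (difference s h g) <= (s%:R * h ^+ s)%:E * period_norm p g0)%E.
Proof.
move=> p1 + h0 Wg mg lg0 pg0 gg0; case: s Wg gg0 => [//|k] [_ dg ag _] gg0 _.
have [mg0 _] := lg0.
have H0 : 0 < k.+1%:R * h by rewrite mulr_gt0.
have c0 : 0 <= k.+1%:R * h ^+ k.+1 by rewrite mulr_ge0// exprn_ge0// ltW.
apply: (period_norm_average (h := k.+1%:R * h)
  (u := fun x t => k.+1%:R * h ^+ k.+1 * g0 (x + t))) => //.
- by apply: mule_ge0; [rewrite lee_fin|exact: period_norm_ge0].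
- apply: measurable_funM => //; have := measurable_affine_pair 1 mg0.
  by apply: eq_measurable_fun => z _; rewrite mul1r.
- exact: measurable_difference.
- move=> x; have [_] := loc_integrableZ (k.+1%:R * h ^+ k.+1) (loc_integrable_shift x lg0).
  exact.
- move=> x.
  apply: (le_trans (difference_le_integral (a := x) (b := x + k.+1%:R * h)
    dg ag lg0 gg0 _ _ _ _)) => //;
    rewrite ?lerDl ?(ltW H0)//.
  have labs := loc_integrable_abs (loc_integrable_shift x lg0).
  under [X in _ <= _ * X]eq_Rintegral do rewrite normrM.
  rewrite RintegralZl//; last by have [_] := labs; exact.
  have := Rintegral_affine_itv x 0 (k.+1%:R * h) ltr01 (loc_integrable_abs lg0).
  rewrite invr1 !mul1r addr0 => <-.
  under [X in _ * X <= _]eq_Rintegral do rewrite mul1r.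
  rewrite (ger0_norm c0) (gtr0_norm h0) mulrA invfM [h ^+ k.+1]exprS.
  rewrite (_ : k.+1%:R^-1 / h * (k.+1%:R * (h * h ^+ k)) = h ^+ k)//.
  rewrite mulrACA mulVf ?pnatr_eq0// mul1r mulrA mulVf ?mul1r//.
  by rewrite gt_eqF.
- move=> t _; rewrite period_normZ//; last exact: measurable_shift.
  by rewrite (ger0_norm c0) period_norm_shift.
Qed.

End norm_bounds.

(** * Discrete norms at separated nodes *)

Section nodes.
Context {R : realType}.
Notation mu := (@lebesgue_measure R).
Implicit Types (f g : R -> R) (a b d x p gamma : R) (k n m : nat) (X : nat -> nat -> R).

(** From a^p = a a^(p - 1) and the monotonicity of the power p - 1. *)
Lemma powR_superadditive p a b : 1 <= p -> 0 <= a -> 0 <= b ->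
  a `^ p + b `^ p <= (a + b) `^ p.
Proof.
move=> p1 a0 b0; have p0 : 0 < p by exact: lt_le_trans p1.
have ab0 : 0 <= a + b by exact: addr_ge0.
rewrite -!(fun u (u0 : 0 <= u) => mulr_powRB1 u0 p0)// mulrDl.
by apply: lerD; rewrite ler_wpM2l// ge0_ler_powR ?nnegrE ?subr_ge0// (lerDl, lerDr).
Qed.

Lemma powR_add_le p a b : 1 <= p -> 0 <= a -> 0 <= b ->
  (a + b) `^ p <= 2 `^ p * (a `^ p + b `^ p).
Proof.
move=> p1 a0 b0; have p0 : 0 <= p by exact: le_trans p1.
wlog ab : a b a0 b0 / a <= b.
  by move=> H; have [/H|/ltW/H] := leP a b; [exact|rewrite [b + a]addrC [_ `^ _ + _]addrC; exact].
apply: (@le_trans _ _ ((2 * b) `^ p)).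
  by rewrite ge0_ler_powR ?nnegrE ?addr_ge0 ?mulr_ge0//; lra.
by rewrite powRM// ler_wpM2l ?powR_ge0// lerDr powR_ge0.
Qed.

Lemma norm_lp_ge0 p X n f : 0 <= norm_lp p X n f.
Proof. exact: powR_ge0. Qed.

Lemma norm_lp_le p X n f b : 1 <= p -> 0 <= b ->
  norm_lp p X n f <= b <-> n%:R^-1 * \sum_(1 <= k < n.+1) `|f (X n k)| `^ p <= b `^ p.
Proof.
move=> p1 b0; have p0 : 0 < p by exact: lt_le_trans p1.
have S0 : 0 <= n%:R^-1 * \sum_(1 <= k < n.+1) `|f (X n k)| `^ p.
  by rewrite mulr_ge0 ?invr_ge0// sumr_ge0// => k _; exact: powR_ge0.
rewrite /norm_lp; set S := _ * _ in S0 *; split => H.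
  have : (S `^ p^-1) `^ p <= b `^ p by rewrite ge0_ler_powR ?nnegrE ?powR_ge0 ?(ltW p0).
  by rewrite -powRrM mulVf ?gt_eqF// powRr1.
have : S `^ p^-1 <= (b `^ p) `^ p^-1.
  by rewrite ge0_ler_powR ?nnegrE ?powR_ge0 ?invr_ge0 ?(ltW p0).
by rewrite -powRrM mulfV ?gt_eqF// powRr1.
Qed.

(** A quasi-triangle inequality; its constant 2 is absorbed in the final
    constants. *)
Lemma norm_lpD p X n f g : 1 <= p ->
  norm_lp p X n (f \+ g) <= 2 * (norm_lp p X n f + norm_lp p X n g).
Proof.
move=> p1; have nf := norm_lp_ge0 p X n f; have ng := norm_lp_ge0 p X n g.
have Hf := (norm_lp_le X n f p1 nf).1 (lexx _).
have Hg := (norm_lp_le X n g p1 ng).1 (lexx _).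
move: (norm_lp p X n f) (norm_lp p X n g) nf ng Hf Hg => u v u0 v0 Hf Hg.
have uv0 : 0 <= 2 * (u + v) by rewrite mulr_ge0// addr_ge0.
apply: (norm_lp_le X n (f \+ g) p1 uv0).2.
rewrite powRM ?addr_ge0//.
apply: le_trans (_ : 2 `^ p * (u `^ p + v `^ p) <= _);
  last by rewrite ler_wpM2l ?powR_ge0// powR_superadditive.
apply: le_trans (ler_wpM2l (powR_ge0 _ _) (lerD Hf Hg)).
rewrite -mulrDr mulrCA ler_wpM2l ?invr_ge0// -big_split/= mulr_sumr.
apply: ler_sum => k _; apply: (le_trans _ (powR_add_le p1 (normr_ge0 _) (normr_ge0 _))).
by rewrite ge0_ler_powR ?nnegrE ?addr_ge0 ?ler_normD// (le_trans _ p1).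
Qed.

Lemma norm_lpN p X n f : norm_lp p X n (fun x => - f x) = norm_lp p X n f.
Proof. by rewrite /norm_lp; under eq_bigr do rewrite normrN. Qed.

Lemma eq_norm_lp p X n f g : f =1 g -> norm_lp p X n f = norm_lp p X n g.
Proof. by move=> /funext ->. Qed.

(** The inequality y(1) <= y(m + 1) is carried along because the intervals are joined
    by induction on m. *)
Lemma sum_disjoint_integral_le (W : R -> \bar R) (y : nat -> R) d m :
  measurable_fun setT W -> (forall x, 0 <= W x)%E -> 0 <= d ->
  (forall k, (1 <= k <= m)%N -> y k + d <= y k.+1) ->
  y 1%N <= y m.+1 /\
  (\sum_(1 <= k < m.+1) \int[mu]_(x in `[y k, (y k + d)%R[) W x <=
   \int[mu]_(x in `[y 1%N, y m.+1[) W x)%E.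
Proof.
move=> mW W0 d0; elim: m => [|m IHm] yk.
  by split => //; rewrite big_geq//; exact: integral_ge0.
have [|y1m IH] := IHm.
  by move=> k /andP[k1 km]; apply: yk; rewrite k1 leqW.
have ym : y m.+1 + d <= y m.+2 by apply: yk; rewrite leqnn.
have ym' : y m.+1 <= y m.+2 by apply: le_trans ym; rewrite lerDl.
split; first exact: le_trans ym'.
rewrite big_nat_recr//= (ge0_integral_itv_cat mW W0 y1m ym'); apply: leeD => //.
apply: ge0_subset_integral => //; first exact: measurable_funS mW.
by move=> x /=; rewrite !in_itv/= => /andP[-> /lt_le_trans ->].
Qed.

(** The windows around the nodes have length gamma / n, at most the distance between
    consecutive nodes, the first and last node being neighbours modulo 1; so they
    fit without overlap in one period. *)
Lemma sum_nodes_integral_le gamma X n (W : R -> \bar R) :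
  measurable_fun setT W -> (forall x, 0 <= W x)%E -> (forall x, W (x + 1) = W x) ->
  0 <= gamma -> separated_nodes gamma X -> (0 < n)%N ->
  (\sum_(1 <= k < n.+1) \int[mu]_(x in `[(X n k - gamma / n%:R / 2)%R,
      (X n k + gamma / n%:R / 2)%R]) W x <= \int[mu]_(x in `[0%R, 1%R[) W x)%E.
Proof.
move=> mW W0 pW g0 /[apply] -[_ _ _ Xn1 Xk]; set d := gamma / n%:R.
have d0 : 0 <= d by rewrite divr_ge0.
pose y k := X n k - d / 2.
have [|_] := @sum_disjoint_integral_le W y d n mW W0 d0.
  by move=> k /Xk; rewrite -/d /y => H; lra.
rewrite (_ : y n.+1 = y 1%N + 1); last by rewrite /y Xn1; ring.
rewrite ge0_integral_period//; apply: le_trans.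
apply: lee_sum => k _.
rewrite (_ : X n k + d / 2 = y k + d); last by rewrite /y; field.
rewrite -integral_itv_bndo_bndc//; exact: measurable_funS mW.
Qed.

(** By Jensen on each window, the mean over the nodes is at most 1 / (n d) = 1 / gamma times
    the integral of |w|^p over the union of the windows, with d = gamma / n. *)
Lemma norm_lp_average p gamma X n (w F : R -> R) b (N : R) : 1 <= p -> 0 < gamma <= 1 ->
  separated_nodes gamma X -> (0 < n)%N -> loc_integrable w -> periodic w 1 ->
  0 <= b -> 0 <= N -> (period_norm p w <= N%:E)%E ->
  (forall x, `|F x| <= b * ((gamma / n%:R)^-1 *
     \int[mu]_(t in `[x - gamma / n%:R / 2, x + gamma / n%:R / 2]) `|w t|)) ->
  norm_lp p X n F <= b * gamma^-1 * N.
Proof.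
move=> p1 /andP[g0 g1] hX n0 lw pw b0 N0 wN FA.
have p0 : 0 < p by exact: lt_le_trans p1.
have [mw iw] := lw.
have nR : 0 < n%:R :> R by rewrite ltr0n.
have d0 : 0 < gamma / n%:R by exact: divr_gt0.
set d := gamma / n%:R in FA d0.
have bg0 : 0 <= b * gamma^-1 by rewrite mulr_ge0// invr_ge0 ltW.
apply: (norm_lp_le X n F p1 (mulr_ge0 bg0 N0)).2.
pose A x := d^-1 * \int[mu]_(t in `[x - d / 2, x + d / 2]) `|w t|.
have A0 x : 0 <= A x.
  by rewrite mulr_ge0 ?invr_ge0 ?(ltW d0)//; apply: Rintegral_ge0.
have S : ((\sum_(1 <= k < n.+1) A (X n k) `^ p)%R%:E <= (d^-1 * N `^ p)%:E)%E.
  rewrite -sumEFin.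
  apply: (@le_trans _ _ (\sum_(1 <= k < n.+1) (d^-1)%:E *
      \int[mu]_(t in `[(X n k - d / 2)%R, (X n k + d / 2)%R]) (`|w t| `^ p)%:E)%E).
    apply: lee_sum => k _.
    have ab : X n k - d / 2 < X n k + d / 2 by lra.
    have := powR_average_le p1 ab mw (iw _ _).
    by rewrite (_ : X n k + d / 2 - (X n k - d / 2) = d)//; field.
  rewrite -ge0_sume_distrr; last first.
    by move=> k _; apply: integral_ge0 => t _; rewrite lee_fin powR_ge0.
  rewrite EFinM lee_wpmul2l ?lee_fin ?invr_ge0 ?(ltW d0)//.
  apply: le_trans ((period_norm_le w p1 _).1 wN); last by rewrite lee_fin.
  apply: (@sum_nodes_integral_le gamma) => //; last exact: ltW.
  - exact: measurable_abs_powR.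
  - by move=> x; rewrite pw.
rewrite lee_fin in S.
apply: (@le_trans _ _ (n%:R^-1 * (b `^ p * \sum_(1 <= k < n.+1) A (X n k) `^ p))).
  rewrite ler_wpM2l ?invr_ge0// mulr_sumr; apply: ler_sum => k _.
  rewrite -(powRM _ b0 (A0 _)).
  exact: (ge0_ler_powR (ltW p0) (normr_ge0 _) (mulr_ge0 b0 (A0 _)) (FA _)).
apply: (@le_trans _ _ (n%:R^-1 * (b `^ p * (d^-1 * N `^ p)))).
  by rewrite ler_wpM2l ?invr_ge0// ler_wpM2l ?powR_ge0.
rewrite !powRM ?invr_ge0 ?(ltW g0)//.
rewrite (_ : n%:R^-1 * _ = b `^ p * gamma^-1 * N `^ p); last first.
  by rewrite /d; field; rewrite !gt_eqF.
rewrite ler_wpM2r ?powR_ge0// ler_wpM2l ?powR_ge0//.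
rewrite -[leLHS]powRr1 ?invr_ge0 ?(ltW g0)// ler_powR// invf_ge1//.
Qed.

End nodes.

(** * Bounds for the K-functional *)

Section assembly.
Context {R : realType}.
Notation mu := (@lebesgue_measure R).
Implicit Types (f g : R -> R) (a b h x p gamma : R) (k n s r : nat) (X : nat -> nat -> R).

Lemma Lp_torus_representative p f : 1 <= p -> Lp_torus p f ->
  exists f0, [/\ loc_integrable f0, periodic f0 1, null_eq f f0 &
    (period_norm p f0 < +oo)%E].
Proof.
move=> p1 [pf mf Nf]; have [f0 [mf0 pf0 ff0]] := lebesgueR_borel_representative pf mf.
have p0 : p != 0 by rewrite gt_eqF// (lt_le_trans ltr01).
rewrite (normLp_period_norm p0 mf0 ff0) in Nf.
by exists f0; split => //; exact: (period_norm_loc_integrable p1).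
Qed.

Lemma null_eq_difference s h f f0 : null_eq f f0 ->
  null_eq (difference s h f) (difference s h f0).
Proof.
move=> ff0; apply: null_eq_sum => k.
apply: (null_eq_comp (fun y => 'C(s, k)%:R * (-1) ^+ k * y)
  (f := fun x => f (x + (s - k)%:R * h)) (g := fun x => f0 (x + (s - k)%:R * h))).
have := null_eq_affine ((s - k)%:R * h) (oner_neq0 R) ff0.
by under eq_fun do rewrite mul1r addrC; under [X in null_eq _ X]eq_fun do rewrite mul1r addrC.
Qed.

Lemma normLp_difference p s h f f0 : 1 <= p -> loc_integrable f0 -> null_eq f f0 ->
  normLp p (difference s h f) = period_norm p (difference s h f0).
Proof.
move=> p1 [mf0 _] ff0; apply: normLp_period_norm.
- by rewrite gt_eqF// (lt_le_trans ltr01).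
- exact: measurable_difference.
- exact: null_eq_difference.
Qed.

Lemma Wsp_continuous s p g : (0 < s)%N -> Wsp s p g -> continuous g.
Proof.
case: s => [//|[|k]] _ [_ dg ag _]; first exact: abs_continuous_continuous.
by apply: derivable_all_continuous; exact: (dg 0%N).
Qed.

(** The constant of [steklov_le]. *)
Definition steklov_bound r : R := 2 * r%:R * \sum_(0 <= nu < r) 'C(2 * r, nu)%:R.

Lemma steklov_bound_ge0 r : 0 <= steklov_bound r.
Proof. by rewrite /steklov_bound mulr_ge0// sumr_ge0. Qed.

Lemma norm_lp_steklov p gamma X n r w w0 N : 1 <= p -> 0 < gamma <= 1 ->
  separated_nodes gamma X -> (0 < n)%N -> (0 < r)%N ->
  loc_integrable w0 -> periodic w0 1 -> null_eq w w0 ->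
  0 <= N -> (period_norm p w0 <= N%:E)%E ->
  norm_lp p X n (steklov (gamma / n%:R) r w) <= steklov_bound r * gamma^-1 * N.
Proof.
move=> p1 hg hX n0 r0 lw pw ww0 N0 wN.
apply: (norm_lp_average p1 hg hX n0 lw pw (steklov_bound_ge0 r) N0 wN) => x.
apply: steklov_le => //; have /andP[g0 _] := hg.
by rewrite divr_gt0// ltr0n.
Qed.

(** The power d^s <= n^-s supplies the weight of the K-functional. *)
Lemma norm_lp_steklov_sub p gamma X n r s g g0 N : 1 <= p -> 0 < gamma <= 1 ->
  separated_nodes gamma X -> (0 < n)%N -> (0 < r)%N -> (0 < s)%N -> (s <= 2 * r)%N ->
  Wsp s p g -> loc_integrable g0 -> periodic g0 1 -> null_eq g^`(s)%classic g0 ->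
  0 <= N -> (period_norm p g0 <= N%:E)%E ->
  norm_lp p X n (steklov (gamma / n%:R) r g \- g) <=
  2 ^+ (2 * r) * gamma^-1 * (n%:R ^- s * N).
Proof.
move=> p1 hg hX n0 r0 s0 sr Wg lg pg gg0 N0 gN.
have nR : 0 < n%:R :> R by rewrite ltr0n.
have /andP[gam0 gam1] := hg.
have d0 : 0 < gamma / n%:R by exact: divr_gt0.
have b0 : 0 <= 2 ^+ (2 * r) * n%:R ^- s :> R by rewrite mulr_ge0 ?invr_ge0// exprn_ge0.
rewrite (_ : _ * _ = 2 ^+ (2 * r) * n%:R ^- s * gamma^-1 * N); last by ring.
apply: (norm_lp_average p1 hg hX n0 lg pg b0 N0 gN) => x.
have cg := Wsp_continuous s0 Wg.
case: s s0 sr Wg gg0 {b0} => [//|k] _ kr [_ dg ag _] gg0.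
apply: (le_trans (steklov_sub_le x dg ag cg lg gg0 r0 kr d0)).
set d := gamma / n%:R in d0 *; set I := \int[mu]_(t in _) _.
have I0 : 0 <= I by apply: Rintegral_ge0.
rewrite -mulrA -[leRHS]mulrA ler_wpM2l ?exprn_ge0// mulrA ler_wpM2r//.
rewrite ler_pdivlMr// -exprSr -exprVn lerXn2r ?nnegrE ?(ltW d0) ?invr_ge0//.
by rewrite ler_pdivrMr// mulVf ?gt_eqF.
Qed.

Lemma norm_lpD3 p X n f g (u : R -> R) a b c : 1 <= p ->
  norm_lp p X n f <= a -> norm_lp p X n g <= b -> norm_lp p X n u <= c ->
  norm_lp p X n (fun x => f x + g x + u x) <= 4 * (a + b + c).
Proof.
move=> p1; have := norm_lpD X n (f \+ g) u p1.
have := norm_lpD X n f g p1; have := norm_lp_ge0 p X n u.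
move: (norm_lp p X n f) (norm_lp p X n g) (norm_lp p X n u) (norm_lp p X n (f \+ g)).
by move: (norm_lp _ _ _ _) => t x y z w; lra.
Qed.

Lemma modulus_le p s d f f0 (B : \bar R) : 1 <= p -> loc_integrable f0 -> null_eq f f0 ->
  (forall h, 0 < h < d -> (period_norm p (difference s h f0) <= B)%E) ->
  (modulus s f d p <= B)%E.
Proof.
move=> p1 lf ff0 fB; apply: ge_ereal_sup => _ [h hd <-].
by rewrite (normLp_difference _ _ p1 lf ff0) fB.
Qed.

Lemma le_modulus p s d f f0 h : 1 <= p -> loc_integrable f0 -> null_eq f f0 ->
  0 < h < d -> (period_norm p (difference s h f0) <= modulus s f d p)%E.
Proof.
move=> p1 lf ff0 hd; rewrite -(normLp_difference _ _ p1 lf ff0).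
by apply: ereal_sup_ubound; exists h.
Qed.

Definition lower_constant gamma r s : R :=
  4 * (1 + steklov_bound r * gamma^-1 + 2 ^+ (2 * r) * gamma^-1) + 2 ^+ s + s%:R.

Definition upper_constant gamma r s : R :=
  4 + (4 * (steklov_bound r * gamma^-1) + 1) * s.+1%:R
    + (4 * (2 ^+ (2 * r) * gamma^-1) + 1) * (4 * s.+1%:R) ^+ s.

(** Holds for every competitor g, so it passes to the infimum.  When |f - g|_p is
    infinite the right-hand side is infinite. *)
Lemma Kfunctional_lower p gamma X n r s f g : 1 <= p -> 0 < gamma <= 1 ->
  separated_nodes gamma X -> (0 < n)%N -> (0 < r)%N -> (0 < s)%N -> (s <= 2 * r)%N ->
  Lp_torus p f -> Wsp s p g ->
  ((norm_lp p X n (steklov (gamma / n%:R) r f \- f)%R)%:E + modulus s f n%:R^-1 p <=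
   (lower_constant gamma r s)%:E * ((norm_lp p X n (f \- g)%R)%:E + normLp p (f \- g)%R
                  + (n%:R ^- s)%:E * normLp p g^`(s)%classic))%E.
Proof.
move=> p1 hg hX n0 r0 s0 sr Lf Wg; set A := lower_constant gamma r s.
have p0 : p != 0 by rewrite gt_eqF// (lt_le_trans ltr01).
have [f0 [lf pf ff0 Nf]] := Lp_torus_representative p1 Lf.
have [g0 [lg pg gg0 Ng]] : exists g0, [/\ loc_integrable g0, periodic g0 1,
    null_eq g^`(s)%classic g0 & (period_norm p g0 < +oo)%E].
  by apply: Lp_torus_representative => //; have [] := Wg.
have cg := Wsp_continuous s0 Wg; have lgc := continuous_loc_integrable cg.
have pgc : periodic g 1 by have [] := Wg.
have [mf0 _] := lf; have [mg0 _] := lg; have [mg _] := lgc.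
have fg0 : null_eq (f \- g) (f0 \- g).
  exact: (null_eq_comp2 (fun u v => u - v) ff0 (null_eq_refl g)).
have lfg : loc_integrable (f0 \- g) by exact: loc_integrableB.
have pfg : periodic (f0 \- g) 1 by move=> x /=; rewrite pf pgc.
have [mfg _] := lfg.
rewrite (normLp_period_norm p0 mfg fg0) (normLp_period_norm p0 mg0 gg0).
have gam0 : 0 <= gamma^-1 by have /andP[? _] := hg; rewrite invr_ge0 ltW.
have B0 := steklov_bound_ge0 r.
have Bg0 : 0 <= steklov_bound r * gamma^-1 by rewrite mulr_ge0.
have Cg0 : 0 <= 2 ^+ (2 * r) * gamma^-1 by rewrite mulr_ge0// exprn_ge0.
have ns0 : 0 <= n%:R ^- s :> R by rewrite invr_ge0 exprn_ge0.
have s20 : 1 <= 2 ^+ s :> R by rewrite exprn_ege1// ler1n.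
have A0 : 0 < A by rewrite /A /lower_constant; have := ler0n R s; lra.
have N10 := norm_lp_ge0 p X n (f \- g).
have G0 := period_norm_ge0 p g0.
case GE : (period_norm p g0) Ng G0 => [G| |]// _ G0.
rewrite lee_fin in G0.
have D0 := period_norm_ge0 p (f0 \- g).
case DE : (period_norm p (f0 \- g)) D0 => [D| |]// D0; last first.
  move: (norm_lp p X n (f \- g)) => N1; rewrite -EFinM.
  rewrite (_ : (N1%:E + +oo + (n%:R ^- s * G)%:E)%E = +oo%E); last by [].
  by rewrite gt0_muley ?lte_fin; [exact: leey|exact: A0].
rewrite lee_fin in D0.
have H1 : norm_lp p X n (steklov (gamma / n%:R) r f \- f) <=
    4 * (steklov_bound r * gamma^-1 * D + 2 ^+ (2 * r) * gamma^-1 * (n%:R ^- s * G)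
         + norm_lp p X n (f \- g)).
  rewrite (@eq_norm_lp _ _ _ _ _ (fun x => steklov (gamma / n%:R) r (f \- g) x +
      (steklov (gamma / n%:R) r g x - g x) + - (f x - g x))); last first.
    by move=> x /=; rewrite -(steklovB _ _ r0 lf ff0 lgc (null_eq_refl g)); ring.
  apply: (norm_lpD3 p1).
  - by apply: (norm_lp_steklov p1 hg hX n0 r0 lfg pfg fg0 D0); rewrite DE.
  - by apply: (norm_lp_steklov_sub p1 hg hX n0 r0 s0 sr Wg lg pg gg0 G0); rewrite GE.
  - by rewrite norm_lpN.
have H2 : (modulus s f n%:R^-1 p <= (2 ^+ s * D + s%:R * (n%:R ^- s * G))%:E)%E.
  apply: (modulus_le p1 lf ff0) => h /andP[h0 hn].
  rewrite (eq_period_norm _ (g := difference s h (f0 \- g) \+ difference s h g)); last first.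
    by move=> x /=; rewrite -differenceD; apply: eq_bigr => k _ /=; rewrite subrK.
  apply: (le_trans (period_normD p1 _ _)).
  - exact: measurable_difference.
  - exact: measurable_difference.
  rewrite EFinD; apply: leeD.
    by rewrite EFinM -DE; exact: period_norm_difference_le.
  apply: (le_trans (period_norm_difference_Wsp p1 s0 h0 Wg mg lg pg gg0)).
  rewrite GE -EFinM lee_fin -mulrA ler_wpM2l// ler_wpM2r//.
  by rewrite -exprVn lerXn2r ?nnegrE ?invr_ge0 ?(ltW h0) ?(ltW hn).
apply: (@le_trans _ _ (_%:E + _%:E)%E); first by apply: leeD H2; rewrite lee_fin; exact: H1.
rewrite -!EFinM -!EFinD lee_fin /A /lower_constant.
move: (n%:R ^- s * G) (mulr_ge0 ns0 G0) => G' G'0.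
move: (norm_lp _ _ _ _) N10 (steklov_bound r * gamma^-1) Bg0 (2 ^+ (2 * r) * gamma^-1) Cg0
  => N N0 B B0' C C0'.
have sR := ler0n R s.
move: (2 ^+ s) (s%:R) s20 sR => u v u1 v0.
have u0 : 0 <= u by exact: le_trans u1.
rewrite -subr_ge0 [leRHS](_ : _ = 4 * (D + G') + 4 * (B * (N + G')) + 4 * (C * (N + D))
  + u * (N + G') + v * (N + D)); last by ring.
by rewrite !addr_ge0 ?mulr_ge0 ?addr_ge0.
Qed.

(** The competitor is the smooth approximation of width a = 1 / (2 n (s + 1)); then all
    steps that occur are at most (s + 1) a = 1 / (2 n), strictly below 1 / n as the modulus
    requires. *)
Lemma Kfunctional_upper p gamma X n r s f : 1 <= p -> 0 < gamma <= 1 ->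
  separated_nodes gamma X -> (0 < n)%N -> (0 < r)%N -> (0 < s)%N -> (s <= 2 * r)%N ->
  Lp_torus p f ->
  (Kfunctional s p X n f <=
   (upper_constant gamma r s)%:E *
   ((norm_lp p X n (steklov (gamma / n%:R) r f \- f)%R)%:E + modulus s f n%:R^-1 p))%E.
Proof.
move=> p1 hg hX n0 r0 s0 sr Lf; set A := upper_constant gamma r s.
have p0 : p != 0 by rewrite gt_eqF// (lt_le_trans ltr01).
have [f0 [lf pf ff0 Nf]] := Lp_torus_representative p1 Lf.
have [mf0 _] := lf.
have nR : 0 < n%:R :> R by rewrite ltr0n.
have ni : 0 < n%:R^-1 :> R by rewrite invr_gt0.
have B0 : (0 <= modulus s f n%:R^-1 p)%E.
  apply: le_trans (le_modulus s (h := n%:R^-1 / 2) p1 lf ff0 _); first exact: period_norm_ge0.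
  by lra.
have Bfin : (modulus s f n%:R^-1 p < +oo)%E.
  apply: (@le_lt_trans _ _ ((2 ^+ s)%:E * period_norm p f0)%E).
    by apply: (modulus_le p1 lf ff0) => h _; exact: period_norm_difference_le.
  by apply: lte_mul_pinfty => //; rewrite lee_fin exprn_ge0.
have HB h : 0 < h < n%:R^-1 ->
    (period_norm p (difference s h f0) <= modulus s f n%:R^-1 p)%E.
  by move=> hn; exact: le_modulus ff0 hn.
move: (modulus s f n%:R^-1 p) B0 Bfin HB => [B| |]// B0 _ HB; rewrite lee_fin in B0.
pose a : R := (2 * n%:R * s.+1%:R)^-1.
have s1R : 0 < s.+1%:R :> R by [].
have a0 : 0 < a by rewrite invr_gt0 !mulr_gt0.
have sa : s.+1%:R * a < n%:R^-1.
  rewrite /a !invfM mulrC mulrVK ?unitfE ?gt_eqF//.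
  lra.
have sa' : s%:R * a < n%:R^-1 by apply: le_lt_trans sa; rewrite ler_wpM2r ?(ltW a0)// ler_nat.
pose g := smoothing s a 0 f0; pose g0 := smoothing s a s f0.
have lg : loc_integrable g0 by apply: continuous_loc_integrable; exact: smoothing_continuous.
have [mg0 _] := lg.
have pg : periodic g0 1 by exact: smoothing_periodic.
have B0' : (0 <= B%:E)%E by rewrite lee_fin.
pose D := s.+1%:R * B; have D0 : 0 <= D by rewrite mulr_ge0.
pose G := (2 / a) ^+ s * B.
have G0 : 0 <= G by rewrite mulr_ge0// exprn_ge0// divr_ge0// ltW.
have HD : (period_norm p (f0 \- g)%R <= D%:E)%E.
  exact: (period_norm_smoothing_sub p1 s0 a0 sa lf pf B0' HB).
have HG : (period_norm p g0 <= G%:E)%E.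
  exact: (period_norm_smoothing_derive p1 a0 sa' lf pf B0' HB).
have Wg : Wsp s p g.
  by apply: smoothing_Wsp => //; apply: (le_lt_trans HG); rewrite ltry.
have gg0 : null_eq g^`(s)%classic g0.
  by rewrite /g smoothing_derive//; exact: null_eq_refl.
have cg : continuous g by exact: smoothing_continuous.
have lgc := continuous_loc_integrable cg.
have pgc : periodic g 1 by exact: smoothing_periodic.
have fg0 : null_eq (f \- g) (f0 \- g).
  exact: (null_eq_comp2 (fun u v => u - v) ff0 (null_eq_refl g)).
have lfg : loc_integrable (f0 \- g) by exact: loc_integrableB.
have pfg : periodic (f0 \- g) 1 by move=> x /=; rewrite pf pgc.
have [mfg _] := lfg.
have nG : n%:R ^- s * G = (4 * s.+1%:R) ^+ s * B.
  rewrite /G mulrA -exprVn -exprMn; congr (_ ^+ _ * _).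
  rewrite /a invrK; field; rewrite gt_eqF//.
set T := norm_lp _ _ _ _.
have H1 : norm_lp p X n (f \- g) <=
    4 * (T + steklov_bound r * gamma^-1 * D + 2 ^+ (2 * r) * gamma^-1 * (n%:R ^- s * G)).
  rewrite (@eq_norm_lp _ _ _ _ _ (fun x => - (steklov (gamma / n%:R) r f x - f x) +
      steklov (gamma / n%:R) r (f \- g) x + (steklov (gamma / n%:R) r g x - g x))); last first.
    by move=> x /=; rewrite -(steklovB _ _ r0 lf ff0 lgc (null_eq_refl g)); ring.
  apply: (norm_lpD3 p1).
  - by rewrite norm_lpN.
  - exact: (norm_lp_steklov p1 hg hX n0 r0 lfg pfg fg0 D0 HD).
  - exact: (norm_lp_steklov_sub p1 hg hX n0 r0 s0 sr Wg lg pg gg0 G0 HG).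
apply: (@le_trans _ _ ((norm_lp p X n (f \- g)%R)%:E + normLp p (f \- g)%R
                  + (n%:R ^- s)%:E * normLp p g^`(s)%classic)%E).
  by apply: ereal_inf_lbound; exists g.
rewrite (normLp_period_norm p0 mfg fg0) (normLp_period_norm p0 mg0 gg0).
apply: (@le_trans _ _ ((4 * (T + steklov_bound r * gamma^-1 * D +
    2 ^+ (2 * r) * gamma^-1 * (n%:R ^- s * G)))%:E + D%:E + (n%:R ^- s * G)%:E)%E).
  apply: leeD; first by apply: leeD => //; rewrite lee_fin.
  by rewrite EFinM lee_wpmul2l// lee_fin invr_ge0 exprn_ge0.
rewrite -!EFinD -EFinM lee_fin nG /A /upper_constant /D.
have T0 : 0 <= T by exact: norm_lp_ge0.
have gam0 : 0 <= gamma^-1 by have /andP[? _] := hg; rewrite invr_ge0 ltW.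
have Bg0 : 0 <= steklov_bound r * gamma^-1 by rewrite mulr_ge0// steklov_bound_ge0.
have Cg0 : 0 <= 2 ^+ (2 * r) * gamma^-1 by rewrite mulr_ge0// exprn_ge0.
have E0 : 0 <= (4 * s.+1%:R) ^+ s :> R by rewrite exprn_ge0// mulr_ge0.
have v0 := ltW s1R; clear -B0 T0 Bg0 Cg0 E0 v0.
move: (s.+1%:R) v0 T T0 (steklov_bound r * gamma^-1) Bg0 (2 ^+ (2 * r) * gamma^-1) Cg0
  ((4 * s.+1%:R) ^+ s) E0 => v v0 T T0 b b0 c c0 e e0.
rewrite -subr_ge0 [leRHS](_ : _ = ((4 * b + 1) * v + (4 * c + 1) * e) * T + 4 * B).
  by rewrite addr_ge0 ?mulr_ge0 ?addr_ge0 ?mulr_ge0 ?addr_ge0 ?mulr_ge0.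
ring.
Qed.

End assembly.

Theorem theorem4p4 (R : realType) (p : R) (r s : nat) (gamma : R)
    (X : nat -> nat -> R)
    (hp : 1 <= p) (hr : (0 < r)%N) (hs : (0 < s)%N) (hsr : (s <= 2 * r)%N)
    (hgamma : 0 < gamma <= 1) (hX : separated_nodes gamma X) :
  exists c C : R, [/\ 0 < c, 0 < C &
    forall (f : R -> R) (n : nat), Lp_torus p f -> (0 < n)%N ->
      let E := ((norm_lp p X n (steklov (gamma / n%:R) r f \- f)%R)%:E
                + modulus s f n%:R^-1 p)%E in
      (c%:E * E <= Kfunctional s p X n f)%E /\
      (Kfunctional s p X n f <= C%:E * E)%E].
Proof.
have gam0 : 0 <= gamma^-1 by have /andP[? _] := hgamma; rewrite invr_ge0 ltW.
have Bg0 : 0 <= steklov_bound r * gamma^-1 by rewrite mulr_ge0// steklov_bound_ge0.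
have Cg0 : 0 <= 2 ^+ (2 * r) * gamma^-1 by rewrite mulr_ge0// exprn_ge0.
have c0 : 0 < lower_constant gamma r s.
  rewrite /lower_constant; have s20 : 0 <= 2 ^+ s :> R by rewrite exprn_ge0.
  by have := ler0n R s; lra.
exists (lower_constant gamma r s)^-1, (upper_constant gamma r s).
split; first by rewrite invr_gt0.
  have v0 : 0 <= (4 * (steklov_bound r * gamma^-1) + 1) * s.+1%:R.
    by rewrite mulr_ge0// addr_ge0// mulr_ge0.
  have w0 : 0 <= (4 * (2 ^+ (2 * r) * gamma^-1) + 1) * (4 * s.+1%:R) ^+ s.
    by rewrite mulr_ge0 ?exprn_ge0 ?addr_ge0 ?mulr_ge0.
  by rewrite /upper_constant; lra.
move=> f n Lf n0 E; split; last exact: Kfunctional_upper.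
apply: le_ereal_inf_tmp => _ [g Wg <-]; rewrite lee_pdivrMl//.
exact: Kfunctional_lower.
Qed.
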